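(* Let $\Omega_0,\Omega_1\subset\mathbb{R}^n$ be bounded domains with $\overline{\Omega}_1\subset\Omega_0$, and let $\Omega=\Omega_0\setminus\overline{\Omega}_1$. Let $u\in C^1(\overline{\Omega})$ satisfy $\Delta u=0$ in $\Omega$, $u=0$ on $\partial\Omega_0$ and $u=1$ on $\partial\Omega_1$, and assume that the gradient $Du$ is nowhere vanishing in $\Omega$. Let $\psi:[0,\infty)\to\mathbb{R}$ be a smooth function satisfying $\psi'(t)-2|\psi''(t)|\,t\ge 0$ for all $t\ge 0$. Define $$\Sigma=\{(x,y)\in\overline{\Omega}\times\overline{\Omega}\ :\ u(x)=u(y)\}$$ and, for $(x,y)\in\Sigma$, $$Q(x,y)=(Du(y)-Du(x))\cdot(y-x)+\psi(|y-x|^2).$$ Then $Q$ does not attain a strict maximum at a point in the interior of $\Sigma$; that is, there is no point $(x_0,y_0)\in\Sigma$ with $x_0,y_0\in\Omega$ such that $Q(x_0,y_0)=\sup_{\Sigma}Q$ and $\sup_{\Sigma}Q>\sup_{\partial\Sigma}Q$.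
   Context: A domain is a nonempty connected open set. No convexity of $\Omega_0$ or $\Omega_1$ is assumed. $u\in C^1(\overline{\Omega})$ means that $u$ is $C^1$ in $\Omega$ and that $u$ and $Du$ extend continuously to $\overline{\Omega}$; $Du$ on $\partial\Omega$ denotes this extension. The interior of $\Sigma$ is the set of $(x,y)\in\Sigma$ with $x,y\in\Omega$, and $\partial\Sigma$ is the set of $(x,y)\in\Sigma$ that are not in the interior of $\Sigma$ (since $u(x)=u(y)$, these are the pairs with both $x$ and $y$ in $\partial\Omega$). *)

(* Defs.v *)
From HB Require Import structures.
From mathcomp Require Import all_boot all_order all_algebra.
From mathcomp Require Import all_classical all_reals all_analysis.

Set Implicit Arguments.
Unset Strict Implicit.
Unset Printing Implicit Defensive.

Import Order.TTheory GRing.Theory Num.Theory.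
Import numFieldNormedType.Exports.

Local Open Scope classical_set_scope.
Local Open Scope ring_scope.

Section Euclidean.
Context {R : realType} {n : nat}.
Implicit Types (A : set 'rV[R]_n) (u : 'rV[R]_n -> R).

(* The library norm on 'rV_n is the sup norm: it is used only for the topology
   and for boundedness; |x|^2 is dotp x x. *)
Definition dotp (x y : 'rV[R]_n) : R := \sum_(i < n) x 0 i * y 0 i.

Definition boundary A : set 'rV[R]_n := closure A `\` interior A.

Definition domain A : Prop := [/\ A !=set0, open A & connected A].

Definition partial (i : 'I_n) u : 'rV[R]_n -> R :=
  fun x => 'D_(delta_mx 0 i) u x.

Definition grad u : 'rV[R]_n -> 'rV[R]_n := fun x => \row_i partial i u x.

Definition laplacian u : 'rV[R]_n -> R :=
  fun x => \sum_(i < n) partial i (partial i u) x.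

(* The next two definitions are meant for open A. *)
Definition C1_on A u : Prop :=
  forall x, A x -> differentiable u x /\ {for x, continuous (grad u)}.

Definition harmonic_on A u : Prop :=
  [/\ C1_on A u, forall i, C1_on A (partial i u)
    & forall x, A x -> laplacian u x = 0].

(* u is C^1 up to the boundary, and Du is the continuous extension of its
   gradient to the closure.  On closure A, where alone it matters, Du is
   determined by u.  The values of u itself on closure A are those of its
   continuous extension. *)
Definition C1_closure A u (Du : 'rV[R]_n -> 'rV[R]_n) : Prop :=
  [/\ C1_on A u,
      {within closure A, continuous u},
      {within closure A, continuous Du}
    & forall x, A x -> Du x = grad u x].

End Euclidean.

Section HalfLine.
Context {R : realType}.
Implicit Types f : R -> R.

(* Derivative relative to [0, +oo[: two-sided at t > 0, right-sided at t = 0;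
   at t >= 0 it depends only on the values of f on [0, +oo[. *)
Definition halfline_quotients f (t : R) :=
  (f s - f t) / (s - t) @[s --> within `[0, +oo[ t^'].

Definition derivable_halfline f t : Prop := cvg (halfline_quotients f t).

Definition derive_halfline f : R -> R := fun t => lim (halfline_quotients f t).

Definition smooth_halfline f : Prop :=
  forall (k : nat) (t : R), 0 <= t ->
    derivable_halfline (iter k derive_halfline f) t.

End HalfLine.

Section TwoPoint.
Context {R : realType} {n : nat}.

Definition Sigma (Omega : set 'rV[R]_n) (u : 'rV[R]_n -> R) :
    set ('rV[R]_n * 'rV[R]_n) :=
  [set p | [/\ closure Omega p.1, closure Omega p.2 & u p.1 = u p.2]].

Definition int_Sigma (Omega : set 'rV[R]_n) (u : 'rV[R]_n -> R) :
    set ('rV[R]_n * 'rV[R]_n) :=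
  [set p | [/\ Sigma Omega u p, Omega p.1 & Omega p.2]].

Definition bd_Sigma (Omega : set 'rV[R]_n) (u : 'rV[R]_n -> R) :
    set ('rV[R]_n * 'rV[R]_n) :=
  Sigma Omega u `\` int_Sigma Omega u.

Definition Q (Du : 'rV[R]_n -> 'rV[R]_n) (psi : R -> R)
    (p : 'rV[R]_n * 'rV[R]_n) : R :=
  dotp (Du p.2 - Du p.1) (p.2 - p.1) + psi (dotp (p.2 - p.1) (p.2 - p.1)).

(* Supremum in the extended reals, so that no boundedness or nonemptiness has
   to be presupposed. *)
Definition supE (F : 'rV[R]_n * 'rV[R]_n -> R)
    (S : set ('rV[R]_n * 'rV[R]_n)) : \bar R :=
  ereal_sup [set (F p)%:E | p in S].

End TwoPoint.

(* Main.v *)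
(* Write z = y - x.  A perturbation Q + eps |x|^2 still has its maximum over
   Sigma at an interior point.  Since u is only given as C^2, Du in Q is not
   differentiated twice: as u(x) = u(y) on Sigma, the difference quotient
   (u(y + h z) - u(x + h z)) / h is close to (Du(y) - Du(x)).z for small h,
   uniformly on a compact superlevel set inside Omega x Omega, so Q can be
   replaced by a function Q_h in which Du does not occur.  At an interior local
   maximum of Q_h + eps |x|^2 off the diagonal (on the diagonal Q_h is
   constant), choose finitely many directions (xi_i, eta_i) tangent to Sigma
   with sum xi_i xi_i^T, sum eta_i eta_i^T and sum (xi_i eta_i^T + eta_i xi_i^T)
   all multiples of the identity.  Summing the second derivatives along curves
   of Sigma in these directions, every term in u is a multiple of the Laplacian
   of u and vanishes, psi contributes a nonnegative amount by the differential
   inequality, and eps |x|^2 contributes 2 n eps > 0: a contradiction. *)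
Require Import Defs.
From HB Require Import structures.
From mathcomp Require Import all_boot all_order all_algebra.
From mathcomp Require Import all_classical all_reals all_analysis.
From mathcomp Require Import ring lra.

Set Implicit Arguments.
Unset Strict Implicit.
Unset Printing Implicit Defensive.

Import Order.TTheory GRing.Theory Num.Theory.
Import numFieldNormedType.Exports.
Local Open Scope classical_set_scope.
Local Open Scope ring_scope.

(** * Second order expansions of real functions *)

(** Peano form of the expansion at 0. It says nothing about derivatives away from 0, so it also
    covers functions chosen pointwise, such as the roots in [level_curve]. *)
Definition taylor2 {R : realType} (f : R -> R) (a b d : R) : Prop :=
  forall e, 0 < e -> \forall s \near (0 : R),
    `|f s - (a + b * s + d * s ^+ 2)| <= e * s ^+ 2.

Section Taylor2.
Context {R : realType}.
Implicit Types (f g : R -> R) (a b d e s : R).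

Lemma near0_small e : 0 < e -> \forall s \near (0 : R), `|s| <= e.
Proof.
move=> e0; exists e => //= s /=; rewrite sub0r normrN => /ltW.
exact.
Qed.

Lemma taylor2_ext f g a b d : f =1 g -> taylor2 f a b d -> taylor2 g a b d.
Proof. by move=> /funext ->. Qed.

Lemma taylor2_poly a b d : taylor2 (fun s => a + b * s + d * s ^+ 2) a b d.
Proof.
move=> e e0; near=> s; rewrite subrr normr0.
by rewrite mulr_ge0 ?sqr_ge0// ltW.
Unshelve. all: by end_near. Qed.

Lemma taylor2_cst a : taylor2 (fun=> a) a 0 0.
Proof. by apply: taylor2_ext (taylor2_poly _ _ _) => s; ring. Qed.

Lemma taylor2D f g a b d a' b' d' : taylor2 f a b d -> taylor2 g a' b' d' ->
  taylor2 (fun s => f s + g s) (a + a') (b + b') (d + d').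
Proof.
move=> ft gt e e0; have e20 : 0 < e / 2 by rewrite divr_gt0.
near=> s.
have H1 : `|f s - (a + b * s + d * s ^+ 2)| <= e / 2 * s ^+ 2.
  by near: s; exact: ft.
have H2 : `|g s - (a' + b' * s + d' * s ^+ 2)| <= e / 2 * s ^+ 2.
  by near: s; exact: gt.
have -> : f s + g s - (a + a' + (b + b') * s + (d + d') * s ^+ 2) =
  (f s - (a + b * s + d * s ^+ 2)) + (g s - (a' + b' * s + d' * s ^+ 2)) by ring.
apply: (le_trans (ler_normD _ _)); lra.
Unshelve. all: by end_near. Qed.

Lemma taylor2Z k f a b d : taylor2 f a b d ->
  taylor2 (fun s => k * f s) (k * a) (k * b) (k * d).
Proof.
move=> ft e e0; have k0 : 0 < `|k| + 1 by rewrite ltr_wpDl.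
have e20 : 0 < e / (`|k| + 1) by rewrite divr_gt0.
near=> s.
have H1 : `|f s - (a + b * s + d * s ^+ 2)| <= e / (`|k| + 1) * s ^+ 2.
  by near: s; exact: ft.
have -> : k * f s - (k * a + k * b * s + k * d * s ^+ 2) =
  k * (f s - (a + b * s + d * s ^+ 2)) by ring.
rewrite normrM; apply: (@le_trans _ _ ((`|k| + 1) * (e / (`|k| + 1) * s ^+ 2))).
  by apply: ler_pM => //; rewrite lerDl.
by rewrite mulrA [_ * (e / _)]mulrC divfK // gt_eqF.
Unshelve. all: by end_near. Qed.

Lemma taylor2_sum (I : finType) (f : I -> R -> R) (a b d : I -> R) :
  (forall i, taylor2 (f i) (a i) (b i) (d i)) ->
  taylor2 (fun s => \sum_i f i s) (\sum_i a i) (\sum_i b i) (\sum_i d i).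
Proof.
move=> ft.
elim: (index_enum I) => [|i r IH].
  rewrite !big_nil; apply: taylor2_ext (taylor2_cst 0) => s.
  by rewrite big_nil.
rewrite !big_cons; apply: taylor2_ext (taylor2D (ft i) IH) => s.
by rewrite big_cons.
Qed.

Lemma taylor2_lipschitz f a b d : taylor2 f a b d ->
  \forall s \near (0 : R), `|f s - a| <= (`|b| + `|d| + 1) * `|s|.
Proof.
move=> ft; near=> s.
have s1 : `|s| <= 1 by near: s; exact: near0_small.
have H : `|f s - (a + b * s + d * s ^+ 2)| <= 1 * s ^+ 2 by near: s; exact: ft.
have s2 : s ^+ 2 <= `|s|.
  by rewrite -real_normK ?num_real// expr2 -[leRHS]mulr1 ler_wpM2l.
have -> : f s - a = (f s - (a + b * s + d * s ^+ 2)) + (b * s + d * s ^+ 2) by ring.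
apply: (le_trans (ler_normD _ _)).
have := ler_normD (b * s) (d * s ^+ 2).
rewrite (normrM b) (normrM d) (ger0_norm (sqr_ge0 s)) => H2.
have : `|d| * s ^+ 2 <= `|d| * `|s| by rewrite ler_wpM2l.
lra.
Unshelve. all: by end_near. Qed.

Lemma taylor2_cvg f a b d : taylor2 f a b d -> f s @[s --> (0 : R)] --> a.
Proof.
move=> /taylor2_lipschitz ft; apply/cvgrPdist_le => e e0.
have C0 : 0 < `|b| + `|d| + 1 by rewrite ltr_wpDl// addr_ge0.
near=> s.
rewrite distrC; apply: (@le_trans _ _ ((`|b| + `|d| + 1) * `|s|)); first by near: s.
rewrite mulrC -ler_pdivlMr//; near: s; apply: near0_small.
by rewrite divr_gt0.
Unshelve. all: by end_near. Qed.

Lemma taylor2_comp (F : R -> R) (g : R -> R) a b d A B D :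
  taylor2 g a b d -> taylor2 (fun t => F (a + t)) A B D ->
  taylor2 (fun s => F (g s)) A (B * b) (B * d + D * b ^+ 2).
Proof.
move=> gt Ft e e0.
set C := `|b| + `|d| + 1.
have C0 : 0 < C by rewrite ltr_wpDl// addr_ge0.
have B0 : 0 < `|B| + 1 by rewrite ltr_wpDl.
have E0 : 0 < (`|D| + 1) * (`|d| + 1) * (C + `|b|).
  by apply: mulr_gt0; [apply: mulr_gt0; rewrite ltr_wpDl|rewrite ltr_wpDr].
near=> s.
set t := g s - a.
have tC : `|t| <= C * `|s| by rewrite /t; near: s; exact: taylor2_lipschitz gt.
have H1 : `|F (a + t) - (A + B * t + D * t ^+ 2)| <= e / (3 * C ^+ 2) * t ^+ 2.
  rewrite /t; near: s.
  have /Ft : 0 < e / (3 * C ^+ 2) by rewrite divr_gt0// mulr_gt0// exprn_gt0.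
  have : g s - a @[s --> (0 : R)] --> (0 : R).
    by rewrite -[X in _ --> X](subrr a); apply: cvgB;
      [exact: taylor2_cvg gt|exact: cvg_cst].
  by apply.
have H2 : `|g s - (a + b * s + d * s ^+ 2)| <= e / (3 * (`|B| + 1)) * s ^+ 2.
  by near: s; apply: gt; rewrite divr_gt0// mulr_gt0.
have H3 : `|g s - (a + b * s + d * s ^+ 2)| <= 1 * s ^+ 2 by near: s; exact: gt.
have H4 : `|s| <= e / (3 * ((`|D| + 1) * (`|d| + 1) * (C + `|b|))).
  by near: s; apply: near0_small; rewrite divr_gt0// mulr_gt0.
(* Three errors, each at most [e / 3 * s ^+ 2]: the remainder of [F] at [t = g s - a], [B] times the
   remainder of [g], and [D * (t ^+ 2 - (b * s) ^+ 2)], whose two factors are of order [s ^+ 2] and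
   [s]. *)
have -> : F (g s) - (A + B * b * s + (B * d + D * b ^+ 2) * s ^+ 2) =
   (F (a + t) - (A + B * t + D * t ^+ 2)) + B * (g s - (a + b * s + d * s ^+ 2))
   + D * ((t - b * s) * (t + b * s)).
  have -> : a + t = g s by rewrite /t; ring.
  by rewrite /t; ring.
have K1 : `|F (a + t) - (A + B * t + D * t ^+ 2)| <= e / 3 * s ^+ 2.
  apply: (le_trans H1); apply: (@le_trans _ _ (e / (3 * C ^+ 2) * (C * `|s|) ^+ 2)).
    rewrite ler_wpM2l//; first by rewrite ltW// divr_gt0// mulr_gt0// exprn_gt0.
    by rewrite -[leLHS]real_normK ?num_real// lerXn2r// nnegrE mulr_ge0// ltW.
  rewrite exprMn real_normK ?num_real// le_eqVlt; apply/orP; left; apply/eqP.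
  by field; rewrite gt_eqF.
have K2 : `|B * (g s - (a + b * s + d * s ^+ 2))| <= e / 3 * s ^+ 2.
  rewrite normrM.
  apply: (@le_trans _ _ ((`|B| + 1) * (e / (3 * (`|B| + 1)) * s ^+ 2))).
    by apply: ler_pM => //; rewrite lerDl.
  rewrite le_eqVlt; apply/orP; left; apply/eqP.
  by field; rewrite gt_eqF.
have K3 : `|D * ((t - b * s) * (t + b * s))| <= e / 3 * s ^+ 2.
  have L1 : `|t - b * s| <= (`|d| + 1) * s ^+ 2.
    have -> : t - b * s = (g s - (a + b * s + d * s ^+ 2)) + d * s ^+ 2.
      by rewrite /t; ring.
    apply: (le_trans (ler_normD _ _)).
    by rewrite (normrM d) (ger0_norm (sqr_ge0 s)); lra.
  have L2 : `|t + b * s| <= (C + `|b|) * `|s|.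
    by apply: (le_trans (ler_normD _ _)); rewrite normrM; lra.
  rewrite !normrM.
  apply: (@le_trans _ _ ((`|D| + 1) * (((`|d| + 1) * s ^+ 2) * ((C + `|b|) * `|s|)))).
    apply: ler_pM; rewrite ?mulr_ge0 ?lerDl//.
    exact: ler_pM.
  have -> : (`|D| + 1) * ((`|d| + 1) * s ^+ 2 * ((C + `|b|) * `|s|)) =
    ((`|D| + 1) * (`|d| + 1) * (C + `|b|)) * `|s| * s ^+ 2 by ring.
  rewrite ler_wpM2r ?sqr_ge0//.
  apply: (le_trans (ler_wpM2l (ltW E0) H4)).
  rewrite le_eqVlt; apply/orP; left; apply/eqP.
  by field; rewrite !gt_eqF//; first rewrite ltr_wpDr//; rewrite ltr_wpDl.
apply: (le_trans (ler_normD _ _)).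
have := ler_normD (F (a + t) - (A + B * t + D * t ^+ 2))
  (B * (g s - (a + b * s + d * s ^+ 2))).
lra.
Unshelve. all: by end_near. Qed.

Lemma taylor2_sqr f a b d : taylor2 f a b d ->
  taylor2 (fun s => f s ^+ 2) (a ^+ 2) (2 * a * b) (2 * a * d + b ^+ 2).
Proof.
move=> ft; rewrite -[b ^+ 2]mul1r.
apply: (@taylor2_comp (fun x => x ^+ 2) _ _ _ _ _ _ _ ft).
by apply: taylor2_ext (taylor2_poly (a ^+ 2) (2 * a) 1) => s; ring.
Qed.

(** Adding the expansions at [s] and [- s] cancels the linear term whatever [b] is; for [d > 0] the
    sum would then exceed [2 * a]. *)
Lemma taylor2_le0 f a b d : taylor2 f a b d ->
  (\forall s \near (0 : R), f s <= a) -> d <= 0.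
Proof.
move=> ft fa; rewrite leNgt; apply/negP => d0.
have d20 : 0 < d / 2 by rewrite divr_gt0.
have : \forall s \near 0^'+, f s <= a /\ f (- s) <= a /\
   `|f s - (a + b * s + d * s ^+ 2)| <= d / 2 * s ^+ 2 /\
   `|f (- s) - (a + b * (- s) + d * (- s) ^+ 2)| <= d / 2 * (- s) ^+ 2.
  have H : \forall s \near (0 : R), f s <= a /\
      `|f s - (a + b * s + d * s ^+ 2)| <= d / 2 * s ^+ 2.
    by apply: filterI fa _; exact: ft.
  have H' : \forall s \near (0 : R), f (- s) <= a /\
      `|f (- s) - (a + b * (- s) + d * (- s) ^+ 2)| <= d / 2 * (- s) ^+ 2.
    have : - s @[s --> (0 : R)] --> (0 : R).
      by rewrite -[X in _ --> X]oppr0; apply: cvgN; exact: cvg_id.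
    by move=> /(_ _ H).
  near=> s.
  have [] : f s <= a /\ `|f s - (a + b * s + d * s ^+ 2)| <= d / 2 * s ^+ 2.
    by near: s; exact: cvg_within H.
  have [] : f (- s) <= a /\
      `|f (- s) - (a + b * (- s) + d * (- s) ^+ 2)| <= d / 2 * (- s) ^+ 2.
    by near: s; exact: cvg_within H'.
  by [].
move=> H.
have [s [s0 []]] : exists s : R, 0 < s /\ (f s <= a /\ f (- s) <= a /\
   `|f s - (a + b * s + d * s ^+ 2)| <= d / 2 * s ^+ 2 /\
   `|f (- s) - (a + b * (- s) + d * (- s) ^+ 2)| <= d / 2 * (- s) ^+ 2).
  apply: (@filter_ex _ (0 : R)^'+ _).
  by apply: filterI H; exact: nbhs_right_gt.
have := exprn_gt0 2 s0.
rewrite sqrrN !ler_norml => ? ? [? [] /andP[? ?] /andP[? ?]].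
have := mulr_gt0 d0 (exprn_gt0 2 s0).
lra.
Unshelve. all: by end_near. Qed.

Lemma taylor2_derive (f df : R -> R) d :
  (\forall t \near (0 : R), is_derive (t : R) 1 f (df t)) -> is_derive (0 : R) 1 df d ->
  taylor2 f (f 0) (df 0) (d / 2).
Proof.
move=> fd [dfd dfE] e e0.
have H0 : \forall t \near (0 : R), `|df t - df 0 - d * t| <= e * `|t|.
  have /derivable1_diffP dd := dfd.
  have := diff_locally dd.
  move=> /eqaddoP /(_ _ e0); apply: filterS => t /=.
  rewrite !fctE /= diff1E// derive1E dfE /shift /= addr0.
  by rewrite /GRing.scale /= opprD addrA [t * d]mulrC.
have [r /= r0 Hr] : exists2 r : R, 0 < r & forall t, `|t| < r ->
    is_derive (t : R) 1 f (df t) /\ `|df t - df 0 - d * t| <= e * `|t|.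
  have [r /= r0 Hr] := filterI fd H0.
  by exists r => // t tr; apply: Hr; rewrite /= sub0r normrN.
exists r => //= s; rewrite /= sub0r normrN => sr.
pose g t := f t - (f 0 + df 0 * t + d / 2 * t ^+ 2).
have gd (t : R) : `|t| < r -> is_derive t 1 g (df t - df 0 - d * t).
  move=> /Hr [ftd _]; rewrite /g.
  by apply: is_derive_eq; rewrite /GRing.scale /=; field.
have g0 : g 0 = 0 by rewrite /g expr0n /= !mulr0 !addr0 subrr.
have gc (t0 : R) : `|t0| < r -> {for t0, continuous g}.
  by move=> /gd [/derivable1_diffP /differentiable_continuous].
(* Since [|c| <= |s|], the factor [e * |c|] bounding the derivative at [c] gives [e * s ^+ 2] in
   all. The two signs of [s] use two different segments. *)
suff [c cs gE] : exists2 c, `|c| <= `|s| & g s - g 0 = (df c - df 0 - d * c) * s.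
  rewrite -/(g s) -[g s]subr0 -{1}g0 gE normrM.
  have /Hr [_ Hc] : `|c| < r by exact: le_lt_trans sr.
  rewrite -[s ^+ 2]real_normK ?num_real// expr2 mulrA ler_wpM2r//.
  by apply: (le_trans Hc); rewrite ler_wpM2l// ltW.
have [s0|s0|s0] := ltrgt0P s; last by exists 0; rewrite ?normr0 ?s0 ?mulr0 ?subrr.
- have [||c /andP[]] := @MVT_segment _ g (fun t => df t - df 0 - d * t) 0 s (ltW s0).
  + move=> t; rewrite in_itv /= => /andP[t0 ts]; apply: gd.
    by rewrite gtr0_norm//; rewrite gtr0_norm// in sr; exact: lt_trans sr.
  + apply: continuous_in_subspaceT => t /set_mem /=; rewrite in_itv /= => /andP[t0 ts].
    by apply: gc; rewrite ger0_norm//; rewrite gtr0_norm// in sr; exact: le_lt_trans sr.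
  + rewrite !bnd_simp => c0 cs; rewrite subr0 => gE; exists c => //.
    by rewrite !ger0_norm// ltW.
- have [||c /andP[]] := @MVT_segment _ g (fun t => df t - df 0 - d * t) s 0 (ltW s0).
  + move=> t; rewrite in_itv /= => /andP[t0 ts]; apply: gd.
    rewrite ltr0_norm//; rewrite ltr0_norm// in sr.
    by apply: lt_trans sr; rewrite ltrN2.
  + apply: continuous_in_subspaceT => t /set_mem /=; rewrite in_itv /= => /andP[t0 ts].
    apply: gc; rewrite ler0_norm//; rewrite ltr0_norm// in sr.
    by apply: le_lt_trans sr; rewrite lerN2.
  + rewrite !bnd_simp => c0 cs; rewrite sub0r => gE; exists c.
      by rewrite !ler0_norm ?lerN2// ltW.
    by rewrite -opprB gE; ring.
Qed.

End Taylor2.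

(** * Conformal pairs of frames *)

Section Frames.
Context {R : realType} {n : nat}.
Implicit Types (p q z : 'rV[R]_n) (H : 'M[R]_n).

Definition qf (H : 'M[R]_n) (v : 'rV[R]_n) : R := (v *m H *m v^T) 0 0.

Lemma dotpE p q : dotp p q = (p *m q^T) 0 0.
Proof. by rewrite mxE; apply: eq_bigr => i _; rewrite mxE. Qed.

Lemma dotp_mx p q : p *m q^T = (dotp p q)%:M.
Proof. by rewrite dotpE; exact: mx11_scalar. Qed.

Lemma dotpC p q : dotp p q = dotp q p.
Proof. by apply: eq_bigr => i _; rewrite mulrC. Qed.

Lemma dotpDl p q z : dotp (p + q) z = dotp p z + dotp q z.
Proof. by rewrite !dotpE mulmxDl mxE. Qed.

Lemma dotpZl k p z : dotp (k *: p) z = k * dotp p z.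
Proof. by rewrite !dotpE -scalemxAl mxE. Qed.

Lemma dotpDr p q z : dotp z (p + q) = dotp z p + dotp z q.
Proof. by rewrite dotpC dotpDl !(dotpC z). Qed.

Lemma dotpZr k p z : dotp z (k *: p) = k * dotp z p.
Proof. by rewrite dotpC dotpZl (dotpC z). Qed.

Lemma dotpNl p z : dotp (- p) z = - dotp p z.
Proof. by rewrite -scaleN1r dotpZl mulN1r. Qed.

Lemma dotpNr p z : dotp z (- p) = - dotp z p.
Proof. by rewrite dotpC dotpNl dotpC. Qed.

Lemma dotpBl p q z : dotp (p - q) z = dotp p z - dotp q z.
Proof. by rewrite dotpDl dotpNl. Qed.

Lemma dotp_ge0 p : 0 <= dotp p p.
Proof. by apply: sumr_ge0 => i _; rewrite -expr2 sqr_ge0. Qed.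

Lemma dotp_eq0 p : (dotp p p == 0) = (p == 0).
Proof.
apply/idP/eqP => [|->]; last first.
  by rewrite /dotp big1// => i _; rewrite mxE mul0r.
rewrite psumr_eq0 => [/allP p0|i _]; last by rewrite -expr2 sqr_ge0.
apply/rowP => i; have := p0 i (mem_index_enum _).
by rewrite -expr2 sqrf_eq0 mxE => /eqP.
Qed.

Lemma dotp_gt0 p : p != 0 -> 0 < dotp p p.
Proof. by move=> p0; rewrite lt_neqAle dotp_ge0 eq_sym dotp_eq0 p0. Qed.

(** By cyclicity of the trace. For a Hessian the right side is a multiple of the Laplacian, which is
    how harmonicity enters. *)
Lemma sum_qf m (V : 'M[R]_(n, m)) H k : V *m V^T = k%:M ->
  \sum_i qf H (col i V)^T = k * \tr H.
Proof.
move=> VV.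
transitivity (\tr (V^T *m H *m V)).
  apply: eq_bigr => i _; rewrite /qf trmxK tr_col -row_mul.
  by rewrite !mxE; apply: eq_bigr => j _; rewrite !mxE.
by rewrite mxtrace_mulC mulmxA VV mul_scalar_mx mxtraceZ.
Qed.

(* With a = p/|p|, b = q/|q| and c = |p|/|q|, the block T is c times the map of
   column vectors that rotates the plane of a and b so as to send a to b and
   multiplies its orthogonal complement by the cosine of the angle; S is a
   multiple of the projection onto that complement, and the block N restores
   the length that T loses there.  If a = b or a = - b then S = 0 and the junk
   value of (Num.sqrt D)^-1 is harmless. *)
Lemma conformal_frames p q : q != 0 ->
  exists (m : nat) (A B : 'M[R]_(n, m)) (k l : R),
    [/\ p *m A = q *m B, A *m A^T = 1%:M, B *m B^T = k%:M
      & A *m B^T + B *m A^T = l%:M].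
Proof.
move=> q0.
have Q0 := dotp_gt0 q0.
set P := dotp p p; set Qq := dotp q q in Q0 *; set c := dotp p q.
(* [W] is skew, kills the orthogonal complement of [p] and [q], and squares to minus their Gram
   determinant [D] on their span; hence [WWW]. *)
pose W := q^T *m p - p^T *m q.
pose D := P * Qq - c ^+ 2.
have WT : W^T = - W.
  by rewrite /W raddfB /= !trmx_mul !trmxK opprB.
have pW : p *m W = c *: p - P *: q.
  by rewrite /W mulmxBr !mulmxA !dotp_mx !mul_scalar_mx.
have qW : q *m W = Qq *: p - c *: q.
  by rewrite /W mulmxBr !mulmxA !dotp_mx !mul_scalar_mx [dotp q p]dotpC.
have WWW : W *m W *m W = - (D *: W).
  have WW : W *m W = q^T *m (c *: p - P *: q) - p^T *m (Qq *: p - c *: q).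
    by rewrite {1}/W mulmxBl -!mulmxA pW qW.
  rewrite WW mulmxBl -!mulmxA !mulmxBl -!scalemxAl pW qW.
  rewrite /D; have -> : c *: (c *: p - P *: q) - P *: (Qq *: p - c *: q) = - (D *: p).
    by rewrite /D; apply/rowP => i; rewrite !mxE; ring.
  have -> : Qq *: (c *: p - P *: q) - c *: (Qq *: p - c *: q) = - (D *: q).
    by rewrite /D; apply/rowP => i; rewrite !mxE; ring.
  by rewrite !mulmxN -!scalemxAr /W scalerBr !opprB opprK addrC.
(* This is the squared Frobenius norm of [W]: its sign gives Cauchy-Schwarz ([D0]), and its
   vanishing forces [W = 0] ([W0]). *)
have trWW : \tr (W *m W^T) = 2 * D.
  rewrite WT mulmxN raddfN /= {1}/W mulmxBl -!mulmxA pW qW.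
  rewrite raddfB /= (mxtrace_mulC q^T) (mxtrace_mulC p^T) !mulmxBl -!scalemxAl !dotp_mx.
  rewrite [dotp q p]dotpC -/P -/Qq -/c /D !scale_scalar_mx.
  by rewrite !raddfB /= !mxtrace_scalar; ring.
have diagWW i : (W *m W^T) i i = \sum_j W i j ^+ 2.
  by rewrite mxE; apply: eq_bigr => j _; rewrite [W^T _ _]mxE expr2.
have diagWW_ge0 i : 0 <= (W *m W^T) i i.
  by rewrite diagWW sumr_ge0// => j _; rewrite sqr_ge0.
have D0 : 0 <= D.
  by rewrite -(pmulr_rge0 _ (ltr0n R 2)) -trWW; apply: sumr_ge0 => i _.
have W0 : D = 0 -> W = 0.
  move=> DE; move: trWW; rewrite DE mulr0 => /eqP.
  rewrite psumr_eq0 => [/allP /= H|i _]; last exact: diagWW_ge0.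
  apply/matrixP => i j; have := H i (mem_index_enum _).
  rewrite diagWW psumr_eq0 => [/allP /= /(_ j (mem_index_enum _))|k _]; last first.
    exact: sqr_ge0.
  by rewrite sqrf_eq0 [RHS]mxE => /eqP.
clearbody W.
pose S := D%:M + W *m W.
have ST : S^T = S.
  by rewrite /S raddfD /= tr_scalar_mx trmx_mul WT mulNmx mulmxN opprK.
have SS : S *m S = D *: S.
  rewrite /S mulmxDl mul_scalar_mx mulmxDr mul_mx_scalar mulmxA WWW.
  by rewrite mulNmx -scalemxAl subrr addr0.
have qS : q *m S = 0.
  rewrite /S mulmxDr mul_mx_scalar mulmxA qW mulmxBl -!scalemxAl pW qW /D.
  by apply/rowP => i; rewrite !mxE; ring.
pose T := Qq^-1 *: (c%:M + W).
have trT : T^T = Qq^-1 *: (c%:M - W).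
  by rewrite linearZ; congr (_ *: _); rewrite linearD /= tr_scalar_mx WT.
pose N := (Qq^-1 * (Num.sqrt D)^-1) *: S.
have NN : N *m N^T = (Qq^-1 ^+ 2) *: S.
  rewrite /N linearZ /= ST -scalemxAl -scalemxAr SS !scalerA.
  have [DE|DN0] := eqVneq D 0.
    by rewrite /S DE W0// mul0mx addr0 -scalemx1 !scale0r !scaler0.
  congr (_ *: _); rewrite -[X in _ * X](sqr_sqrtr D0); field.
  by rewrite gt_eqF// gt_eqF// sqrtr_gt0 lt_neqAle eq_sym DN0.
have TT : T *m T^T = (Qq^-1 ^+ 2) *: ((c ^+ 2)%:M - W *m W).
  rewrite trT /T -scalemxAl -scalemxAr scalerA.
  congr (_ *: _); rewrite mulmxDl !mulmxBr -scalar_mxM mul_scalar_mx mul_mx_scalar.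
  by rewrite subrKA.
(* Here [q *m T = p] and [q *m N = 0]; the skew part [W] cancels in [T + T^T]; the terms in [W *m W]
   cancel in [T *m T^T + N *m N^T], leaving [c ^+ 2 + D = P * Qq] over [Qq ^+ 2]. *)
exists (n + n)%N, (row_mx 1%:M 0), (row_mx T N), (P / Qq), (2 * (c / Qq)); split.
- rewrite !mul_mx_row mulmx1 mulmx0; congr row_mx.
    rewrite /T -scalemxAr mulmxDr mul_mx_scalar qW addrC subrK scalerA mulVf ?scale1r//.
    by rewrite gt_eqF.
  by rewrite /N -scalemxAr qS scaler0.
- by rewrite tr_row_mx mul_row_col trmx1 mulmx1 trmx0 mulmx0 addr0.
- rewrite tr_row_mx mul_row_col TT NN -scalerDr /S addrCA addrC subrK -raddfD /=.
  rewrite scale_scalar_mx; congr (_%:M); rewrite /D; field.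
  by rewrite gt_eqF.
- rewrite !tr_row_mx !mul_row_col trmx1 trmx0 !mulmx0 mul0mx !addr0 mul1mx mulmx1.
  rewrite trT /T -scalerDr.
  have -> : c%:M - W + (c%:M + W) = (c + c)%:M by rewrite addrCA subrK -raddfD.
  by rewrite scale_scalar_mx; congr (_%:M); ring.
Qed.

End Frames.

(** * Twice differentiable functions along curves *)

Section Calculus.
Context {R : realType} {n : nat}.
Implicit Types (A : set 'rV[R]_n) (u : 'rV[R]_n -> R) (x y z v w p q : 'rV[R]_n).

Definition hessian u z : 'M[R]_n := \matrix_(i, j) partial i (partial j u) z.

Lemma tr_hessian u z : \tr (hessian u z) = laplacian u z.
Proof. by apply: eq_bigr => i _; rewrite mxE. Qed.

Lemma coord_le_norm z i : `|z 0 i| <= `|z|.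
Proof.
rewrite [leRHS]/Num.norm /= mx_normrE.
exact: (le_bigmax _ (fun ij => `|z ij.1 ij.2|) (0, i)).
Qed.

Lemma dotp_le_norm x y : `|dotp x y| <= n%:R * (`|x| * `|y|).
Proof.
apply: (le_trans (ler_norm_sum _ _ _)).
have -> : n%:R * (`|x| * `|y|) = \sum_(i < n) (`|x| * `|y|).
  by rewrite sumr_const card_ord mulr_natl.
by apply: ler_sum => i _; rewrite normrM ler_pM// coord_le_norm.
Qed.

Lemma derive_grad u z v : differentiable u z -> 'D_v u z = dotp (grad u z) v.
Proof.
move=> du; rewrite deriveE// {1}(row_sum_delta v) linear_sum.
by apply: eq_bigr => i _; rewrite linearZ /= -deriveE// mxE mulrC.
Qed.

Lemma is_derive_line u z v (s : R) : differentiable u (z + s *: v) ->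
  is_derive s 1 (fun t => u (z + t *: v)) (dotp (grad u (z + s *: v)) v).
Proof.
move=> du.
have E : (fun h : R => h^-1 *: (((fun t => u (z + t *: v)) \o shift s) (h *: 1) -
     u (z + s *: v))) =
   (fun h : R => h^-1 *: ((u \o shift (z + s *: v)) (h *: v) - u (z + s *: v))).
  apply/funext => h /=; congr (_ *: (u _ - _)).
  have -> : h *: (1 : R) = h by exact: mulr1.
  by rewrite scalerDl addrCA.
split; first by rewrite /derivable E; exact: diff_derivable.
by rewrite /derive E -derive_grad.
Qed.

Lemma norm_segment z z1 z2 (r c : R) : 0 <= c <= 1 ->
  `|z - z1| < r -> `|z - z2| < r -> `|z - (z1 + c *: (z2 - z1))| < r.
Proof.
move=> /andP[c0 c1] H1 H2.
have -> : z - (z1 + c *: (z2 - z1)) = (1 - c) *: (z - z1) + c *: (z - z2).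
  by apply/rowP => i; rewrite !mxE; ring.
apply: (le_lt_trans (ler_normD _ _)); rewrite !normrZ (ger0_norm c0).
rewrite ger0_norm ?subr_ge0//.
have r0 : 0 < r by exact: le_lt_trans H1.
have [->|cn0] := eqVneq c 0; first by rewrite subr0 mul1r mul0r addr0.
have cp : 0 < c by rewrite lt_neqAle eq_sym cn0.
have := ler_wpM2l (ltac:(by rewrite subr_ge0) : 0 <= 1 - c) (ltW H1).
have := ltr_pM2l cp `|z - z2| r; rewrite H2 => K1 K2.
have -> : r = (1 - c) * r + c * r by ring.
by rewrite ler_ltD.
Qed.

(** Mean value theorem on the segment from [z1] to [z2], in a ball where the gradient varies little.
    The gradient is read at a third point: [z] itself for curves, the moving base point for
    difference quotients. *)
Lemma strict_diff A u z (e : R) : open A -> C1_on A u -> A z -> 0 < e ->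
  exists2 r, 0 < r & forall z1 z2 z3,
    `|z - z1| < r -> `|z - z2| < r -> `|z - z3| < r ->
    A z1 /\ `|u z2 - u z1 - dotp (grad u z3) (z2 - z1)| <= e * `|z2 - z1|.
Proof.
move=> oA C1 Az e0.
have N0 : 0 < n%:R + 1 :> R by rewrite ltr_wpDl.
(* The factor [n] comes from bounding [dotp] by sup norms, the 2 from passing through [grad u z];
   [n%:R + 1] is positive even for [n = 0]. *)
have e20 : 0 < e / (2 * (n%:R + 1)) by rewrite divr_gt0// mulr_gt0.
have H1 : \forall t \near z, A t by exact: open_nbhs_nbhs.
have /cvgr_dist_lt /(_ _ e20) H2 := (C1 _ Az).2.
have [r /= r0 Hr] := (nbhs_normP _ _).1 (filterI H1 H2).
exists r => // z1 z2 z3 Hz1 Hz2 Hz3; split; first exact: (Hr _ Hz1).1.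
pose phi t := u (z1 + t *: (z2 - z1)).
have seg t : 0 <= t <= 1 -> `|z - (z1 + t *: (z2 - z1))| < r.
  by move=> /norm_segment; apply.
have dphi (t : R) : 0 <= t <= 1 ->
    is_derive t 1 phi (dotp (grad u (z1 + t *: (z2 - z1))) (z2 - z1)).
  move=> t01; apply: is_derive_line.
  by have [At _] := Hr _ (seg _ t01); have [] := C1 _ At.
have [||c c01 cE] := @MVT_segment R phi
    (fun t => dotp (grad u (z1 + t *: (z2 - z1))) (z2 - z1)) 0 1 ler01.
- by move=> t; rewrite in_itv /= => /andP[t0 t1]; apply: dphi; rewrite !ltW.
- apply: continuous_in_subspaceT => t /set_mem /=; rewrite in_itv /= => t01.
  by have [/derivable1_diffP /differentiable_continuous] := dphi _ t01.
move: cE; rewrite /phi scale1r scale0r addr0 subrKC subr0 mulr1 => ->.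
rewrite -dotpBl.
move: c01; rewrite in_itv /= => /seg/Hr[_ /= Hc].
have [_ /= H3] := Hr _ Hz3.
apply: (le_trans (dotp_le_norm _ _)); rewrite mulrA ler_wpM2r//.
have Hg : `|grad u (z1 + c *: (z2 - z1)) - grad u z3| <= e / (n%:R + 1).
  rewrite -(subrKA (grad u z)); apply: (le_trans (ler_normD _ _)).
  rewrite distrC in Hc.
  have -> : e / (n%:R + 1) = e / (2 * (n%:R + 1)) + e / (2 * (n%:R + 1)).
    by field; rewrite gt_eqF.
  by apply: lerD; exact: ltW.
apply: (@le_trans _ _ ((n%:R + 1) * (e / (n%:R + 1)))).
  by apply: ler_pM => //; rewrite lerDl.
by rewrite mulrC divfK// gt_eqF.
Qed.

End Calculus.

(** * Expansions of [u] along curves, and curves of pairs with equal values *)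

Section Curves.
Context {R : realType} {n : nat}.
Implicit Types (A : set 'rV[R]_n) (u : 'rV[R]_n -> R) (x y z v w p q xi eta : 'rV[R]_n).

Definition C2_on A u := C1_on A u /\ forall i, C1_on A (partial i u).

Lemma taylor2_affine_small z v w (f : R -> R) (a b d e : R) :
  taylor2 f a b d -> a = 0 -> 0 < e ->
  \forall s \near (0 : R), `|z - (z + s *: v + f s *: w)| < e.
Proof.
move=> ft a0 e0; rewrite a0 in ft.
have K0 : 0 < `|v| + (`|b| + `|d| + 1) * `|w| + 1.
  by rewrite ltr_wpDl// addr_ge0// mulr_ge0// ltW// ltr_wpDl// addr_ge0.
near=> s.
have -> : z - (z + s *: v + f s *: w) = - (s *: v + f s *: w).
  by rewrite -addrA opprD addNKr.
rewrite normrN; apply: (le_lt_trans (ler_normD _ _)); rewrite !normrZ.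
have fs : `|f s| <= (`|b| + `|d| + 1) * `|s|.
  by rewrite -[f s]subr0; near: s; exact: taylor2_lipschitz ft.
have : `|s| <= e / (2 * (`|v| + (`|b| + `|d| + 1) * `|w| + 1)).
  by near: s; apply: near0_small; rewrite divr_gt0// mulr_gt0.
rewrite ler_pdivlMr ?mulr_gt0// => se.
have := ler_wpM2r (normr_ge0 w) fs.
have := normr_ge0 s.
nra.
Unshelve. all: by end_near. Qed.

Lemma taylor2_line A u z v : open A -> C2_on A u -> A z ->
  taylor2 (fun s => u (z + s *: v)) (u z) (dotp (grad u z) v)
    (qf (hessian u z) v / 2).
Proof.
move=> oA [C1 C2] Az.
pose df t := dotp (grad u (z + t *: v)) v.
have z0 : z = z + (0 : R) *: v by rewrite scale0r addr0.
have -> : u z = (fun s => u (z + s *: v)) 0 by rewrite /= -z0.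
have -> : dotp (grad u z) v = df 0 by rewrite /df -z0.
apply: taylor2_derive.
  have oAz : \forall t \near z, A t by exact: open_nbhs_nbhs.
  have [r /= r0 Hr] := (nbhs_normP _ _).1 oAz.
  near=> t; apply: is_derive_line.
  suff /C1[] : A (z + t *: v) by [].
  apply: Hr => /=; rewrite -[z + t *: v]addr0 -(scale0r v).
  by near: t; apply: (taylor2_affine_small z v v (taylor2_cst (0 : R))).
have -> : df = \sum_(j < n) (fun t => v 0 j *: partial j u (z + t *: v)).
  apply/funext => t; rewrite fct_sumE; apply: eq_bigr => j _.
  by rewrite mxE mulrC.
have -> : qf (hessian u z) v = \sum_(j < n) v 0 j *: dotp (grad (partial j u) z) v.
  rewrite /qf mxE; apply: eq_bigr => j _; rewrite [v^T _ _]mxE mulrC; congr (_ * _).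
  by rewrite mxE; apply: eq_bigr => i _; rewrite !mxE mulrC.
apply: is_derive_sum => j; apply: is_deriveZ.
rewrite {2}z0; apply: is_derive_line; rewrite -z0.
by have [] := C2 j _ Az.
Unshelve. all: by end_near. Qed.

Lemma strict_diff_line A u z v w (e : R) : open A -> C1_on A u -> A z -> 0 < e ->
  exists2 r, 0 < r & \forall s \near (0 : R), forall t, `|t| <= r ->
    A (z + s *: v + t *: w) /\
    `|u (z + s *: v + t *: w) - u (z + s *: v) - t * dotp (grad u z) w| <= e * `|t|.
Proof.
move=> oA C1 Az e0.
have w0 : 0 < `|w| + 1 by rewrite ltr_wpDl.
have v0 : 0 < `|v| + 1 by rewrite ltr_wpDl.
have [r r0 Hr] := strict_diff oA C1 Az (divr_gt0 e0 w0).
exists (r / (2 * (`|w| + 1))) => [|]; first by rewrite divr_gt0// mulr_gt0.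
near=> s => t; rewrite ler_pdivlMr ?mulr_gt0// => tr.
have : `|s| <= r / (4 * (`|v| + 1)).
  by near: s; apply: near0_small; rewrite divr_gt0// mulr_gt0.
rewrite ler_pdivlMr ?mulr_gt0// => sr.
have Hs : `|z - (z + s *: v)| < r.
  rewrite opprD addNKr normrN normrZ.
  have := normr_ge0 s; nra.
have Ht : `|z - (z + s *: v + t *: w)| < r.
  rewrite -addrA opprD addNKr normrN; apply: (le_lt_trans (ler_normD _ _)).
  rewrite !normrZ; have := normr_ge0 s; have := normr_ge0 t; nra.
have zz : `|z - z| < r by rewrite subrr normr0.
split; first by have [] := Hr _ _ _ Ht Hs zz.
have [_] := Hr _ _ _ Hs Ht zz.
rewrite [z + s *: v + _]addrC addrK dotpZr normrZ => /le_trans; apply.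
have -> : e / (`|w| + 1) * (`|t| * `|w|) = e * `|t| * (`|w| / (`|w| + 1)).
  by field; rewrite gt_eqF.
by rewrite ler_piMr ?mulr_ge0 ?(ltW e0)// ler_pdivrMr// mul1r lerDl.
Unshelve. all: by end_near. Qed.

(** The displacement along [w] is of second order, so only the first derivative in that direction
    enters. Strict differentiability compares the curve with the line, uniformly in the base point
    [z + s *: v]. *)
Lemma taylor2_curve A u z v w (f : R -> R) k : open A -> C2_on A u -> A z ->
  taylor2 f 0 0 k ->
  taylor2 (fun s => u (z + s *: v + f s *: w)) (u z) (dotp (grad u z) v)
    (qf (hessian u z) v / 2 + dotp (grad u z) w * k).
Proof.
move=> oA C2 Az ft.
set D := dotp (grad u z) w.
have H1 := taylor2_line v oA C2 Az.
have H2 : taylor2 (fun s => u (z + s *: v + f s *: w) - u (z + s *: v) - f s * D) 0 0 0.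
  move=> e e0.
  have k0 : 0 < `|k| + 1 by rewrite ltr_wpDl.
  have [r r0 Hr] := strict_diff_line v w oA C2.1 Az (divr_gt0 e0 k0).
  near=> s.
  have fr : `|f s| <= r.
    near: s; have /cvgrPdist_le /(_ _ r0) := taylor2_cvg ft.
    by apply: filterS => s; rewrite sub0r normrN.
  have fk : `|f s| <= (`|k| + 1) * s ^+ 2.
    have : `|f s - (0 + 0 * s + k * s ^+ 2)| <= 1 * s ^+ 2 by near: s; exact: ft.
    rewrite mul0r !add0r mul1r => H.
    rewrite -[f s](subrK (k * s ^+ 2)); apply: (le_trans (ler_normD _ _)).
    by rewrite (normrM k) (ger0_norm (sqr_ge0 s)) [leRHS]mulrDl mul1r addrC lerD2l.
  have [_] : A (z + s *: v + f s *: w) /\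
    `|u (z + s *: v + f s *: w) - u (z + s *: v) - f s * D| <= e / (`|k| + 1) * `|f s|.
    by move: (f s) fr {fk}; near: s.
  rewrite !mul0r !addr0 subr0 => /le_trans; apply.
  apply: (le_trans (ler_wpM2l _ fk)); first by rewrite ltW// divr_gt0.
  by rewrite mulrA divfK// gt_eqF.
have := taylor2D (taylor2D H2 H1) (taylor2Z D ft).
rewrite !mulr0 !addr0 !add0r.
by apply: taylor2_ext => s; rewrite (mulrC D); ring.
Unshelve. all: by end_near. Qed.

(* An implicit function is not needed: for small s the intermediate value theorem
   gives some root t = f s near 0, and every such root is k s^2 + o(s^2). *)
Lemma level_curve A u x y xi eta : open A -> C2_on A u -> A x -> A y ->
  u x = u y -> grad u y != 0 -> dotp (grad u x) xi = dotp (grad u y) eta ->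
  exists2 f : R -> R,
    taylor2 f 0 0 ((qf (hessian u x) xi - qf (hessian u y) eta) /
                   (2 * dotp (grad u y) (grad u y)))
    & \forall s \near (0 : R), u (x + s *: xi) = u (y + s *: eta + f s *: grad u y).
Proof.
move=> oA C2 Ax Ay uxy q0 pq.
set q := grad u y in q0 pq *; set Q2 := dotp q q.
have Q0 : 0 < Q2 by exact: dotp_gt0.
set K := (qf _ _ - qf _ _).
(* The gap that the root must close. Equal values at [x] and [y] and tangency cancel its terms of
   order 0 and 1. *)
pose del s := u (x + s *: xi) - u (y + s *: eta).
have delt : taylor2 del 0 0 (K / 2).
  have := taylor2D (taylor2_line xi oA C2 Ax)
    (taylor2Z (-1) (taylor2_line eta oA C2 Ay)).
  rewrite uxy pq !mulN1r !subrr -mulrBl.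
  by apply: taylor2_ext => s; rewrite mulN1r.
pose C := `|K / 2| + 1.
have C0 : 0 < C by rewrite ltr_wpDl.
have delC : \forall s \near (0 : R), `|del s| <= C * s ^+ 2.
  near=> s.
  have : `|del s - (0 + 0 * s + (K / 2) * s ^+ 2)| <= 1 * s ^+ 2 by near: s; exact: delt.
  rewrite mul0r !add0r mul1r => H.
  rewrite -[del s](subrK (K / 2 * s ^+ 2)); apply: (le_trans (ler_normD _ _)).
  by rewrite /C (normrM (K / 2)) (ger0_norm (sqr_ge0 s)) [leRHS]mulrDl mul1r addrC lerD2l.
(* With error at most half the slope [Q2], moving by [r] or [- r] along [q] changes [u] by at least
   [r * Q2 / 2] in either sense, so the intermediate value theorem applies once [|del s|] is below
   this. *)
have [r r0 Hr] := strict_diff_line eta q oA C2.1 Ay (divr_gt0 Q0 (ltr0n R 2)).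
pose P s t := `|t| <= r /\ u (x + s *: xi) = u (y + s *: eta + t *: q).
(* The default 0 is taken only when no root exists, which does not happen for small [s]. *)
pose f s := xget 0 (P s).
have fP : \forall s \near (0 : R), P s (f s).
  near=> s; suff [t Pt] : exists t, P s t by exact: (xgetI _ Pt).
  have Hs : forall t, `|t| <= r -> A (y + s *: eta + t *: q) /\
    `|u (y + s *: eta + t *: q) - u (y + s *: eta) - t * Q2| <= Q2 / 2 * `|t|.
    by near: s.
  have ds : `|del s| <= r * Q2 / 2.
    near: s; have /cvgrPdist_le := taylor2_cvg delt.
    have rQ : 0 < r * Q2 / 2 by rewrite divr_gt0// mulr_gt0.
    by move=> /(_ _ rQ); apply: filterS => s; rewrite sub0r normrN.
  have [_ Hp] := Hs r (ltac:(by rewrite gtr0_norm)).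
  have [_ Hn] := Hs (- r) (ltac:(by rewrite normrN gtr0_norm)).
  move: ds Hp Hn; rewrite normrN (gtr0_norm r0) !ler_norml /del.
  move=> /andP[? ?] /andP[? ?] /andP[? ?].
  have rr : - r <= r by lra.
  have [||t] := @IVT R (fun t => u (y + s *: eta + t *: q)) _ _ (u (x + s *: xi)) rr.
  - apply: continuous_in_subspaceT => t /set_mem /=; rewrite in_itv /= -ler_norml => tr.
    have [At _] := Hs _ tr.
    have [du _] := C2.1 _ At.
    by have [/derivable1_diffP /differentiable_continuous] := is_derive_line du.
  - rewrite ge_min le_max; apply/andP; split; apply/orP; [left|right]; nra.
  rewrite in_itv /= -ler_norml => tr tE.
  by exists t; split.
exists f; last by apply: filterS fP => s [].
(* First pass: the error [Q2 / 2 * |f s|] is absorbed on the left, giving f = O(s^2). *)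
have fC : \forall s \near (0 : R), `|f s| <= 2 * C / Q2 * s ^+ 2.
  near=> s.
  have [fr fE] : P s (f s) by near: s.
  have [_] : A (y + s *: eta + f s *: q) /\
    `|u (y + s *: eta + f s *: q) - u (y + s *: eta) - f s * Q2| <= Q2 / 2 * `|f s|.
    by move: (f s) fr {fE}; near: s.
  rewrite -fE -/(del s) => H.
  have dC : `|del s| <= C * s ^+ 2 by near: s.
  have : `|f s * Q2| <= Q2 / 2 * `|f s| + C * s ^+ 2.
    rewrite -[f s * Q2](subKr (del s)); apply: (le_trans (ler_normB _ _)); lra.
  rewrite normrM (gtr0_norm Q0) => H2.
  rewrite mulrAC ler_pdivlMr//; lra.
move=> e e0.
(* Second pass: this constant times the bound [2 * C / Q2] of the first pass is [e * Q2 / 2], half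
   of the allowed error after multiplication by [Q2]. *)
have e10 : 0 < e * Q2 ^+ 2 / (4 * C) by rewrite divr_gt0// mulr_gt0// exprn_gt0.
have [r1 r10 Hr1] := strict_diff_line eta q oA C2.1 Ay e10.
near=> s.
have [fr fE] : P s (f s) by near: s.
have fsC : `|f s| <= 2 * C / Q2 * s ^+ 2 by near: s.
have fr1 : `|f s| <= r1.
  apply: (le_trans fsC).
  have : `|s| <= Num.min 1 (r1 / (2 * C / Q2)).
    by near: s; apply: near0_small; rewrite lt_min ltr01 divr_gt0// divr_gt0// mulr_gt0.
  rewrite le_min => /andP[s1]; rewrite ler_pdivlMr ?divr_gt0 ?mulr_gt0// => sr.
  apply: le_trans sr; rewrite mulrC; apply: ler_wpM2r.
    by rewrite ltW// divr_gt0// mulr_gt0.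
  by rewrite -real_normK ?num_real// expr2 ler_piMl.
have [_] : A (y + s *: eta + f s *: q) /\
    `|u (y + s *: eta + f s *: q) - u (y + s *: eta) - f s * Q2|
      <= e * Q2 ^+ 2 / (4 * C) * `|f s|.
  by move: (f s) fr1 {fr fE fsC}; near: s.
rewrite -fE -/(del s) => H.
have : `|del s - (0 + 0 * s + (K / 2) * s ^+ 2)| <= (e * Q2 / 2) * s ^+ 2.
  by near: s; apply: delt; rewrite divr_gt0// mulr_gt0.
rewrite mul0r !add0r => H2.
have H3 : e * Q2 ^+ 2 / (4 * C) * `|f s| <= e * Q2 / 2 * s ^+ 2.
  apply: (le_trans (ler_wpM2l (ltW e10) fsC)).
  rewrite le_eqVlt; apply/orP; left; apply/eqP; field.
  by rewrite !gt_eqF.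
rewrite -(ler_pM2l Q0) -{1}(gtr0_norm Q0) -normrM.
have -> : Q2 * (f s - K / (2 * Q2) * s ^+ 2) =
   (del s - K / 2 * s ^+ 2) - (del s - f s * Q2) by field; rewrite gt_eqF.
apply: (le_trans (ler_normB _ _)); lra.
Unshelve. all: by end_near. Qed.

End Curves.

(** * Functions on the half-line *)

Section Halfline.
Context {R : realType}.
Implicit Types f : R -> R.

Lemma halfline_quotientsP f t (l : R) : halfline_quotients f t --> l ->
  forall e, 0 < e -> exists2 r, 0 < r &
    forall s, 0 <= s -> `|t - s| < r -> `|f s - f t - l * (s - t)| <= e * `|s - t|.
Proof.
move=> fl e e0.
have /cvgrPdist_lt /(_ _ e0) [r /= r0 Hr] := fl.
exists r => // s s0 sr.
have [->|st] := eqVneq s t; first by rewrite !subrr mulr0 subrr !normr0 mulr0.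
have := Hr s sr st; rewrite /= in_itv /= s0 /= => /(_ isT) H.
have st0 : s - t != 0 by rewrite subr_eq0.
have -> : f s - f t - l * (s - t) = - (l - (f s - f t) / (s - t)) * (s - t).
  by field.
by rewrite normrM normrN ler_wpM2r// ltW.
Qed.

Lemma is_derive_halfline f (t : R) : 0 < t -> derivable_halfline f t ->
  is_derive t 1 f (derive_halfline f t).
Proof.
move=> t0 ft; set l := derive_halfline f t.
suff H : h^-1 *: ((f \o shift t) (h *: (1 : R)) - f t) @[h --> (0 : R)^'] --> l.
  by split; [apply/cvg_ex; exists l|exact: cvg_lim H].
apply/cvgrPdist_le => e e0.
have [r r0 Hr] := halfline_quotientsP ft e0.
exists (Num.min r t) => /=; first by rewrite lt_min r0.
move=> h /=; rewrite sub0r normrN lt_min => /andP[hr ht] h0.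
have -> : h *: (1 : R) = h by exact: mulr1.
rewrite /=.
have ht0 : 0 <= h + t.
  by move: ht; rewrite ltr_norml => /andP[]; lra.
have := Hr _ ht0; rewrite opprD addrCA subrr addr0 normrN => /(_ hr).
rewrite addrK => H.
have -> : l - h^-1 *: (f (h + t) - f t) = - (f (h + t) - f t - l * h) / h.
  by rewrite /GRing.scale /=; field.
by rewrite normrM normrN normfV ler_pdivrMr// normr_gt0.
Qed.

Lemma halfline_continuous f t (e : R) : derivable_halfline f t -> 0 < e ->
  exists2 r, 0 < r & forall s, 0 <= s -> `|t - s| < r -> `|f t - f s| < e.
Proof.
move=> ft e0; set l := derive_halfline f t.
have [r r0 Hr] := halfline_quotientsP ft ltr01.
have L0 : 0 < `|l| + 2 by rewrite ltr_wpDl.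
exists (Num.min r (e / (`|l| + 2))); first by rewrite lt_min r0 divr_gt0.
move=> s s0; rewrite lt_min ltr_pdivlMr// => /andP[sr se].
have := Hr _ s0 sr; rewrite mul1r -/l => H.
have -> : f t - f s = - ((f s - f t - l * (s - t)) + l * (s - t)) by ring.
rewrite normrN; apply: (le_lt_trans (ler_normD _ _)); rewrite normrM.
rewrite distrC in se; have := normr_ge0 (s - t); nra.
Qed.

Lemma taylor2_halfline f (t : R) : 0 < t -> (forall s, 0 <= s -> derivable_halfline f s) ->
  derivable_halfline (derive_halfline f) t ->
  taylor2 (fun h => f (t + h)) (f t) (derive_halfline f t)
    (derive_halfline (derive_halfline f) t / 2).
Proof.
move=> t0 df ddf.
have dt (g : R -> R) (s l : R) : is_derive (t + s) 1 g l ->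
    is_derive s 1 (fun h => g (t + h)) l.
  move=> gl; rewrite -[l]mulr1.
  apply: (@is_derive1_comp R g (fun h => t + h) s l 1 gl).
  have -> : (fun h => t + h) = shift t by apply/funext => h; rewrite /= addrC.
  exact: is_derive_shift.
have E0 : t = t + 0 by rewrite addr0.
have -> : f t = (fun h => f (t + h)) 0 by rewrite /= addr0.
have -> : derive_halfline f t = (fun h => derive_halfline f (t + h)) 0 by rewrite /= addr0.
apply: (@taylor2_derive R (fun h => f (t + h)) (fun h => derive_halfline f (t + h)));
  last by apply: (dt (derive_halfline f)); rewrite addr0; exact: is_derive_halfline.
near=> s.
have : `|s| <= t / 2 by near: s; apply: near0_small; rewrite divr_gt0.
rewrite ler_norml => /andP[st _].
by apply: (dt f); apply: is_derive_halfline; [lra|apply: df; lra].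
Unshelve. all: by end_near. Qed.

End Halfline.

(** * Limits of scalar products and of [psi] at squared lengths *)

Section Continuity.
Context {R : realType} {n : nat}.

Lemma cvg_dotp {T : Type} {F : set_system T} {FF : Filter F} (f g : T -> 'rV[R]_n) a b :
  f @ F --> a -> g @ F --> b -> dotp (f t) (g t) @[t --> F] --> dotp a b.
Proof.
move=> fa gb.
have H i : (f t 0 i * g t 0 i) @[t --> F] --> a 0 i * b 0 i.
  apply: cvgM; [exact: (cvg_comp _ _ fa (@coord_continuous _ _ _ _ _ _))
               |exact: (cvg_comp _ _ gb (@coord_continuous _ _ _ _ _ _))].
rewrite /dotp; elim: (index_enum _) => [|i r IH].
  by under eq_cvg do rewrite big_nil; rewrite big_nil; exact: cvg_cst.
by under eq_cvg do rewrite big_cons; rewrite big_cons; exact: cvgD.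
Qed.

(** Continuity of [psi] relative to the half-line suffices, as squared lengths are nonnegative. *)
Lemma cvg_halfline_dotp {T : Type} {F : set_system T} {FF : Filter F}
    (psi : R -> R) (f : T -> 'rV[R]_n) a :
  (forall s, 0 <= s -> derivable_halfline psi s) ->
  f @ F --> a -> psi (dotp (f t) (f t)) @[t --> F] --> psi (dotp a a).
Proof.
move=> dpsi fa; apply/cvgrPdist_lt => e e0.
have [r r0 Hr] := halfline_continuous (dpsi _ (dotp_ge0 a)) e0.
have H : dotp (f t) (f t) @[t --> F] --> dotp a a by exact: cvg_dotp.
have /cvgrPdist_lt /(_ _ r0) := H.
by apply: filterS => t /(Hr _ (dotp_ge0 _)).
Qed.

End Continuity.

(** * The local maximum principle *)

Section TwoPointLocal.
Context {R : realType} {n : nat}.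
Implicit Types (A : set 'rV[R]_n) (u : 'rV[R]_n -> R) (x y z v w p q xi eta : 'rV[R]_n).

Lemma taylor2_dotp z v w (f : R -> R) k : taylor2 f 0 0 k ->
  taylor2 (fun s => dotp (z + s *: v + f s *: w) (z + s *: v + f s *: w))
    (dotp z z) (2 * dotp z v) (dotp v v + 2 * dotp z w * k).
Proof.
move=> ft.
have ci i : taylor2 (fun s => (z + s *: v + f s *: w) 0 i) (z 0 i) (v 0 i) (w 0 i * k).
  have := taylor2D (taylor2_poly (z 0 i) (v 0 i) 0) (taylor2Z (w 0 i) ft).
  rewrite !mulr0 !addr0 add0r.
  by apply: taylor2_ext => s; rewrite !mxE; ring.
have := taylor2_sum (fun i => taylor2_sqr (ci i)).
have -> : \sum_i z 0 i ^+ 2 = dotp z z by apply: eq_bigr => i _; rewrite expr2.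
have -> : \sum_i 2 * z 0 i * v 0 i = 2 * dotp z v.
  by rewrite mulr_sumr; apply: eq_bigr => i _; rewrite mulrA.
have -> : \sum_i (2 * z 0 i * (w 0 i * k) + v 0 i ^+ 2) = dotp v v + 2 * dotp z w * k.
  rewrite mulr_sumr mulr_suml -big_split /=; apply: eq_bigr => i _; ring.
by apply: taylor2_ext => s; apply: eq_bigr => i _; rewrite expr2.
Qed.

Lemma cvg_curve x v w (f : R -> R) k : taylor2 f 0 0 k ->
  x + s *: v + f s *: w @[s --> (0 : R)] --> x.
Proof.
move=> ft; apply/cvgrPdist_lt => e e0.
exact: (taylor2_affine_small x v w ft).
Qed.

(** The values [u p.1] and [u p.2] are left out of the difference quotients because they cancel on
    [Sigma]; off [Sigma] this does not approximate the perturbed [Q]. *)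
Definition quotient_Q u (psi : R -> R) (h eps : R) (p : 'rV[R]_n * 'rV[R]_n) : R :=
  h^-1 * (u (p.2 + h *: (p.2 - p.1)) - u (p.1 + h *: (p.2 - p.1)))
  + psi (dotp (p.2 - p.1) (p.2 - p.1)) + eps * dotp p.1 p.1.

(** The shifted points [x + h *: z] and [y + h *: z] move, to first order, by fixed linear
    combinations of [xi] and [eta], so each Hessian is evaluated on such a combination. *)
Lemma quotient_Q_curve A u psi h eps x y xi eta (f : R -> R) k :
  open A -> C2_on A u ->
  A (x + h *: (y - x)) -> A (y + h *: (y - x)) -> x != y ->
  (forall t, 0 <= t -> derivable_halfline psi t) ->
  (forall t, 0 <= t -> derivable_halfline (derive_halfline psi) t) ->
  taylor2 f 0 0 k ->
  let q := grad u y in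
  let z := y - x in
  let t := dotp z z in
  taylor2 (fun s => quotient_Q u psi h eps (x + s *: xi, y + s *: eta + f s *: q))
    (quotient_Q u psi h eps (x, y))
    (h^-1 * (dotp (grad u (y + h *: z)) ((1 + h) *: eta - h *: xi)
             - dotp (grad u (x + h *: z)) ((1 - h) *: xi + h *: eta))
     + derive_halfline psi t * (2 * dotp z (eta - xi))
     + eps * (2 * dotp x xi))
    (h^-1 * ((qf (hessian u (y + h *: z)) ((1 + h) *: eta - h *: xi) / 2
              + dotp (grad u (y + h *: z)) ((1 + h) *: q) * k)
             - (qf (hessian u (x + h *: z)) ((1 - h) *: xi + h *: eta) / 2
                + dotp (grad u (x + h *: z)) (h *: q) * k))
     + (derive_halfline psi t * (dotp (eta - xi) (eta - xi) + 2 * dotp z q * k)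
        + derive_halfline (derive_halfline psi) t / 2 * (2 * dotp z (eta - xi)) ^+ 2)
     + eps * dotp xi xi).
Proof.
move=> oA C2 Ax Ay xy dpsi ddpsi ft q z t.
(* Off the diagonal [t] is interior to the half-line, so [psi] has a two-sided expansion there. *)
have t0 : 0 < t by apply: dotp_gt0; rewrite subr_eq0 eq_sym.
have T1 := taylor2_curve ((1 + h) *: eta - h *: xi) ((1 + h) *: q) oA C2 Ay ft.
have T2 := taylor2_curve ((1 - h) *: xi + h *: eta) (h *: q) oA C2 Ax ft.
have T3 := taylor2_comp (taylor2_dotp z (eta - xi) q ft)
  (taylor2_halfline t0 dpsi (ddpsi _ (ltW t0))).
have T4 := taylor2_dotp x xi 0 (taylor2_cst 0).
have := taylor2D (taylor2D (taylor2Z h^-1 (taylor2D T1 (taylor2Z (-1) T2))) T3)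
  (taylor2Z eps T4).
rewrite !mulN1r mulr0 addr0.
rewrite /quotient_Q /=.
apply: taylor2_ext => s; rewrite mulN1r scaler0 addr0 -/z.
congr (_ * (u _ - u _) + psi _ + _).
- by apply/rowP => i; rewrite !mxE; ring.
- by apply/rowP => i; rewrite !mxE; ring.
- have -> // : z + s *: (eta - xi) + f s *: q = y + s *: eta + f s *: q - (x + s *: xi).
  by apply/rowP => i; rewrite !mxE; ring.
Qed.

Lemma two_point_no_local_max A u psi h eps x y :
  open A -> harmonic_on A u -> A x -> A y -> u x = u y -> grad u y != 0 ->
  A (x + h *: (y - x)) -> A (y + h *: (y - x)) -> x != y ->
  (forall t, 0 <= t -> derivable_halfline psi t) ->
  (forall t, 0 <= t -> derivable_halfline (derive_halfline psi) t) ->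
  (forall t, 0 <= t -> 0 <= derive_halfline psi t
          - 2 * `|derive_halfline (derive_halfline psi) t| * t) ->
  0 < eps ->
  ~ \forall p \near (x, y), u p.1 = u p.2 ->
      quotient_Q u psi h eps p <= quotient_Q u psi h eps (x, y).
Proof.
move=> oA [C1 C1' harm] Ax Ay uxy q0 Axh Ayh xy dpsi ddpsi psi_ineq eps0 lmax.
have C2 : C2_on A u by [].
have [m [M [N [k [l [pMqN MM NN MN]]]]]] := conformal_frames (grad u x) q0.
set q := grad u y in q0 pMqN; set z := y - x in Axh Ayh.
set t := dotp z z.
have t0 : 0 < t by apply: dotp_gt0; rewrite subr_eq0 eq_sym.
pose xi i := (col i M)^T; pose eta i := (col i N)^T.
have tangent i : dotp (grad u x) (xi i) = dotp q (eta i).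
  by rewrite !dotpE !trmxK !colE !mulmxA pMqN.
(* The three frame identities make [a *: M + b *: N] times its transpose scalar for all [a] and [b],
   so every combination of directions sums to a trace. *)
have sum_comb H (a b : R) :
    \sum_i qf H (a *: xi i + b *: eta i) = (a ^+ 2 + b ^+ 2 * k + a * b * l) * \tr H.
  rewrite -(@sum_qf _ _ _ (a *: M + b *: N)).
    by apply: eq_bigr => i _; congr qf; apply/rowP => j; rewrite !mxE.
  have -> : (a ^+ 2 + b ^+ 2 * k + a * b * l)%:M =
      a ^+ 2 *: (M *m M^T) + b ^+ 2 *: (N *m N^T) + (a * b) *: (M *m N^T + N *m M^T).
    by rewrite MM NN MN !scale_scalar_mx -!raddfD /= mulr1.
  rewrite linearD /= !linearZ /= mulmxDl !mulmxDr -!scalemxAl -!scalemxAr.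
  move: (M *m M^T) (N *m N^T) (M *m N^T) (N *m M^T) => P1 P2 P3 P4.
  by apply/matrixP => i j; rewrite !mxE; ring.
have sum_hess z0 (a b : R) : A z0 ->
    \sum_i qf (hessian u z0) (a *: xi i + b *: eta i) = 0.
  by move=> Az0; rewrite sum_comb tr_hessian harm// mulr0.
have /choice [f Hf] : forall i, exists f : R -> R,
    taylor2 f 0 0 ((qf (hessian u x) (xi i) - qf (hessian u y) (eta i)) / (2 * dotp q q))
    /\ \forall s \near (0 : R), u (x + s *: xi i) = u (y + s *: eta i + f s *: q).
  move=> i; have [f ft fE] := level_curve oA C2 Ax Ay uxy q0 (tangent i).
  by exists f.
pose kap i := (qf (hessian u x) (xi i) - qf (hessian u y) (eta i)) / (2 * dotp q q).
(* The corrections [kap i] that keep the curves in [Sigma] sum to zero by harmonicity, which removes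
   every term in [g1], [g2] and [dotp z q]. *)
have sum_kap : \sum_i kap i = 0.
  rewrite -mulr_suml sumrB.
  have -> : \sum_i qf (hessian u x) (xi i) = 0.
    rewrite -[RHS](sum_hess x 1 0 Ax).
    by apply: eq_bigr => i _; rewrite scale1r scale0r addr0.
  have -> : \sum_i qf (hessian u y) (eta i) = 0.
    rewrite -[RHS](sum_hess y 0 1 Ay).
    by apply: eq_bigr => i _; rewrite scale1r scale0r add0r.
  by rewrite subrr mul0r.
pose g1 := dotp (grad u (y + h *: z)) q.
pose g2 := dotp (grad u (x + h *: z)) q.
pose psi1 := derive_halfline psi t.
pose psi2 := derive_halfline (derive_halfline psi) t.
(* All terms but the one in [kap i] are written with [qf] so that [sum_comb] applies; [z^T *m z] has
   quadratic form [dotp z v ^+ 2]. *)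
have second_variation i :
  h^-1 / 2 * qf (hessian u (y + h *: z)) (- h *: xi i + (1 + h) *: eta i)
  + - (h^-1 / 2) * qf (hessian u (x + h *: z)) ((1 - h) *: xi i + h *: eta i)
  + (h^-1 * ((1 + h) * g1 - h * g2) + 2 * psi1 * dotp z q) * kap i
  + psi1 * qf 1%:M (- 1 *: xi i + 1 *: eta i)
  + 2 * psi2 * qf (z^T *m z) (- 1 *: xi i + 1 *: eta i)
  + eps * qf 1%:M (1 *: xi i + 0 *: eta i) <= 0.
  have [ft fE] := Hf i.
  have T := quotient_Q_curve eps (xi i) (eta i) oA C2 Axh Ayh xy dpsi ddpsi ft.
  have near_le : \forall s \near (0 : R),
      quotient_Q u psi h eps (x + s *: xi i, y + s *: eta i + f i s *: q) <=
      quotient_Q u psi h eps (x, y).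
    have c1 : x + s *: xi i @[s --> (0 : R)] --> x.
      have := @cvg_curve x (xi i) 0 _ _ (taylor2_cst 0).
      by under eq_cvg do rewrite scaler0 addr0.
    have c2 := @cvg_curve y (eta i) q _ _ ft.
    have c : (x + s *: xi i, y + s *: eta i + f i s *: q) @[s --> (0 : R)] --> (x, y).
      exact: cvg_pair c1 c2.
    by apply: filterS2 fE (c _ lmax) => s fE /(_ fE).
  have := taylor2_le0 T near_le; rewrite -/q -/z -/t; apply: le_trans.
  have qf1 v : qf 1%:M v = dotp v v by rewrite /qf mulmx1 dotpE.
  have qfz v : qf (z^T *m z) v = dotp z v ^+ 2.
    rewrite /qf !mulmxA -mulmxA dotp_mx dotp_mx.
    by rewrite -scalar_mxM mxE mulr1n [dotp v z]dotpC expr2.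
  rewrite !qf1 !qfz !dotpZr -/g1 -/g2 -/psi1 -/psi2 -/(kap i).
  rewrite scale1r scale0r addr0 scaleN1r scale1r scaleNr.
  rewrite [- xi i + _]addrC [- _ + (1 + h) *: _]addrC.
  rewrite le_eqVlt; apply/orP; left; apply/eqP.
  by move: (h^-1) => hi; field.
have : \sum_i (
  h^-1 / 2 * qf (hessian u (y + h *: z)) (- h *: xi i + (1 + h) *: eta i)
  + - (h^-1 / 2) * qf (hessian u (x + h *: z)) ((1 - h) *: xi i + h *: eta i)
  + (h^-1 * ((1 + h) * g1 - h * g2) + 2 * psi1 * dotp z q) * kap i
  + psi1 * qf 1%:M (- 1 *: xi i + 1 *: eta i)
  + 2 * psi2 * qf (z^T *m z) (- 1 *: xi i + 1 *: eta i)
  + eps * qf 1%:M (1 *: xi i + 0 *: eta i)) <= 0.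
  by apply: sumr_le0 => i _.
rewrite !big_split /= -!mulr_sumr !sum_hess// sum_kap !sum_comb.
have -> : \tr (z^T *m z) = t.
  by rewrite mxtrace_mulC dotp_mx mxtrace_scalar.
rewrite mxtrace1 !mulr0 !add0r.
(* [x != y] rules out dimension 0. *)
have n1 : 1 <= n%:R :> R.
  rewrite ler1n lt0n; apply/eqP => n0.
  by move: t0; rewrite /t /dotp big1 ?ltxx// => i; have := ltn_ord i; rewrite {2}n0.
(* [n] times this number is the sum of the squared lengths of the [eta i - xi i]. *)
have K0 : 0 <= (- 1) ^+ 2 + 1 ^+ 2 * k + - 1 * 1 * l.
  rewrite -(pmulr_lge0 _ (lt_le_trans ltr01 n1)) -(mxtrace1 R) -sum_comb.
  apply: sumr_ge0 => i _; rewrite /qf mulmx1 -dotpE; exact: dotp_ge0.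
move: K0; set K := (X in 0 <= X) => K0.
have := psi_ineq t (ltW t0); rewrite -/psi1 -/psi2 => Hpsi.
(* The terms in [psi] sum to [K * (psi1 * n%:R + 2 * psi2 * t)], nonnegative by this bound together
   with [psi1 >= 0] and [n >= 1]. *)
have Hpsi2 : 0 <= psi1 + 2 * psi2 * t.
  have : - `|psi2| * t <= psi2 * t by apply: ler_wpM2r; [exact: ltW|exact: lerNnormlW].
  lra.
have psi10 : 0 <= psi1 by have := mulr_ge0 (normr_ge0 psi2) (ltW t0); lra.
have : psi1 <= psi1 * n%:R by rewrite ler_peMr.
move=> Hn.
have : 0 <= K * (psi1 * n%:R + 2 * psi2 * t) by apply: mulr_ge0 => //; lra.
have : 0 < eps * n%:R by rewrite mulr_gt0// (lt_le_trans ltr01 n1).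
rewrite -/K; have -> : 1 ^+ 2 + 0 ^+ 2 * k + 0 * l = 1 :> R by ring.
lra.
Qed.

End TwoPointLocal.

(** * Maxima on the diagonal, and approximation by difference quotients *)

Section TwoPointGlobal.
Context {R : realType} {n : nat}.
Implicit Types (A : set 'rV[R]_n) (u : 'rV[R]_n -> R) (x y z v w p q xi eta : 'rV[R]_n).

(** Diagonal pairs always have equal values, and there only [eps * dotp y y] varies; along a line in
    direction [v] it is strictly convex. *)
Lemma diagonal_no_local_max u psi h eps x v : v != 0 -> 0 < eps ->
  ~ \forall p \near (x, x), u p.1 = u p.2 ->
      quotient_Q u psi h eps p <= quotient_Q u psi h eps (x, x).
Proof.
move=> v0 eps0 lmax.
have H y : quotient_Q u psi h eps (y, y) = psi (dotp (0 : 'rV[R]_n) 0) + eps * dotp y y.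
  by rewrite /quotient_Q /= !subrr mulr0 add0r.
have c1 : x + s *: v + (0 : R) *: (0 : 'rV[R]_n) @[s --> (0 : R)] --> x.
  exact: (@cvg_curve _ _ x v 0 _ _ (taylor2_cst 0)).
have c : (x + s *: v + (0 : R) *: (0 : 'rV[R]_n), x + s *: v + (0 : R) *: (0 : 'rV[R]_n))
   @[s --> (0 : R)] --> (x, x) by exact: (cvg_pair c1 c1).
have T := taylor2D (taylor2_cst (psi (dotp (0 : 'rV[R]_n) 0)))
  (taylor2Z eps (taylor2_dotp x v 0 (taylor2_cst 0))).
have := taylor2_le0 T.
rewrite add0r mulr0 addr0 => H2.
have : eps * dotp v v <= 0.
  apply: H2; near=> s; rewrite -lerBlDl -addrA.
  have : quotient_Q u psi h eps (x + s *: v + (0 : R) *: 0, x + s *: v + (0 : R) *: 0)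
     <= quotient_Q u psi h eps (x, x).
    have : u (x + s *: v + (0 : R) *: 0) = u (x + s *: v + (0 : R) *: 0) by [].
    by near: s; exact: (c _ lmax).
  by rewrite !H; lra.
by rewrite leNgt mulr_gt0// dotp_gt0.
Unshelve. all: by end_near. Qed.

(** Strict differentiability at [x] and [y], with gradients at the moving base points, bounds the
    error by a small multiple of [h] before division by [h]. One radius serves all nearby pairs and
    all small [h], as the compactness argument requires. *)
Lemma quotient_approx A u x y (e : R) : open A -> C1_on A u -> A x -> A y -> 0 < e ->
  exists2 r, 0 < r & forall x' y' h, `|x - x'| < r -> `|y - y'| < r -> 0 < h -> h < r ->
    [/\ A (x' + h *: (y' - x')), A (y' + h *: (y' - x'))
      & `|h^-1 * ((u (y' + h *: (y' - x')) - u y') - (u (x' + h *: (y' - x')) - u x'))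
         - dotp (grad u y' - grad u x') (y' - x')| < e].
Proof.
move=> oA C1 Ax Ay e0.
(* Bounds [|y' - x'|] when [x'] and [y'] are within 1 of [x] and [y]. *)
pose Z := `|y - x| + 2.
have Z0 : 0 < Z by rewrite ltr_wpDl.
have e10 : 0 < e / (4 * Z) by rewrite divr_gt0// mulr_gt0.
have [rx rx0 Hx] := strict_diff oA C1 Ax e10.
have [ry ry0 Hy] := strict_diff oA C1 Ay e10.
pose r0 := Num.min rx ry.
have r00 : 0 < r0 by rewrite lt_min rx0.
exists (Num.min 1 (Num.min (r0 / 2) (r0 / (2 * Z)))).
  by rewrite !lt_min ltr01 !divr_gt0// mulr_gt0.
move=> x' y' h; rewrite !lt_min => /and3P[x1 x2 _] /and3P[y1 y2 _] h0 /and3P[h1 h2].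
rewrite ltr_pdivlMr ?mulr_gt0// => h3.
set z := y' - x'.
have zZ : `|z| <= Z.
  have -> : z = (y - x) + ((x - x') - (y - y')).
    by apply/rowP => i; rewrite !mxE; ring.
  apply: (le_trans (ler_normD _ _)).
  by have := ler_normB (x - x') (y - y'); rewrite /Z; lra.
have hz : `|h *: z| < r0 / 2.
  rewrite normrZ gtr0_norm//; have := ler_wpM2l (ltW h0) zZ; lra.
have x3 : `|x - (x' + h *: z)| < r0.
  by rewrite opprD addrA; apply: (le_lt_trans (ler_normB _ _)); lra.
have y3 : `|y - (y' + h *: z)| < r0.
  by rewrite opprD addrA; apply: (le_lt_trans (ler_normB _ _)); lra.
have x4 : `|x - x'| < r0 by lra.
have y4 : `|y - y'| < r0 by lra.
move: x3 x4 y3 y4; rewrite !lt_min => /andP[x3 _] /andP[x4 _] /andP[_ y3] /andP[_ y4].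
have [Ax' Bx] := Hx _ _ _ x4 x3 x4.
have [Ay' By] := Hy _ _ _ y4 y3 y4.
split; [exact: (Hx _ _ _ x3 x3 x3).1|exact: (Hy _ _ _ y3 y3 y3).1|].
rewrite ![_ + h *: z - _]addrAC subrr add0r dotpZr normrZ (gtr0_norm h0) in Bx.
rewrite ![_ + h *: z - _]addrAC subrr add0r dotpZr normrZ (gtr0_norm h0) in By.
rewrite -(ltr_pM2l h0) -{1}(gtr0_norm h0) -normrM.
have -> : h * (h^-1 * (u (y' + h *: z) - u y' - (u (x' + h *: z) - u x')) -
    dotp (grad u y' - grad u x') z) =
    (u (y' + h *: z) - u y' - h * dotp (grad u y') z) -
    (u (x' + h *: z) - u x' - h * dotp (grad u x') z).
  by rewrite dotpBl; field; rewrite gt_eqF.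
apply: (le_lt_trans (ler_normB _ _)).
apply: (le_lt_trans (lerD By Bx)).
have : e / (4 * Z) * (h * `|z|) <= h * e / 4.
  apply: (@le_trans _ _ (e / (4 * Z) * (h * Z))).
    by apply: ler_wpM2l; [exact: ltW|apply: ler_wpM2l => //; exact: ltW].
  by rewrite le_eqVlt; apply/orP; left; apply/eqP; field; rewrite gt_eqF.
have := mulr_gt0 h0 e0; lra.
Qed.

Lemma bounded_closure A : bounded_set A ->
  exists2 M : R, 0 <= M & forall x, closure A x -> `|x| <= M.
Proof.
move=> [M [Mreal HM]].
exists (`|M| + 2) => [|x clx]; first by rewrite addr_ge0.
have [y [Ay /=]] := clx _ (nbhsx_ballx x 1 ltr01).
rewrite -ball_normE /= => xy.
have : `|y| <= `|M| + 1.
  by apply: HM => //; rewrite ltr_pwDr// ler_norm.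
have := ler_normD (x - y) y; rewrite subrK; lra.
Qed.

End TwoPointGlobal.

(** * Compactness *)

Lemma nbhs_fst {U V : topologicalType} (p : U * V) : q.1 @[q --> p] --> p.1.
Proof. by case: p => p1 p2; exact: (@cvg_fst _ _ (nbhs p1) (nbhs p2)). Qed.

Lemma nbhs_snd {U V : topologicalType} (p : U * V) : q.2 @[q --> p] --> p.2.
Proof. by case: p => p1 p2; exact: (@cvg_snd _ _ (nbhs p1) (nbhs p2)). Qed.

Section TwoPointCompactness.
Context {R : realType} {n : nat}.
Implicit Types (A : set 'rV[R]_n) (u : 'rV[R]_n -> R).

Definition perturbed_Q (Du : 'rV[R]_n -> 'rV[R]_n) psi (eps : R)
  (p : 'rV[R]_n * 'rV[R]_n) : R := Q Du psi p + eps * dotp p.1 p.1.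

Lemma cvg_within_fst {U V T : topologicalType} (A : set U) (B : set V) (f : U -> T)
    (p : U * V) :
  {within A, continuous f} -> A p.1 ->
  f q.1 @[q --> within (A `*` B) (nbhs p)] --> f p.1.
Proof.
move=> /subspace_continuousP cf A1 P /(cf _ A1) /= nP.
have H : \forall q \near p, A q.1 -> P (f q.1).
  exact: (@cvg_fst _ _ (nbhs p.1) (nbhs p.2) _ _ nP).
change (\forall q \near p, (A `*` B) q -> P (f q.1)).
by apply: filterS H => q H [/H].
Qed.

Lemma cvg_within_snd {U V T : topologicalType} (A : set U) (B : set V) (f : V -> T)
    (p : U * V) :
  {within B, continuous f} -> B p.2 ->
  f q.2 @[q --> within (A `*` B) (nbhs p)] --> f p.2.
Proof.
move=> /subspace_continuousP cf B2 P /(cf _ B2) /= nP.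
have H : \forall q \near p, B q.2 -> P (f q.2).
  exact: (@cvg_snd _ _ (nbhs p.1) (nbhs p.2) _ _ nP).
change (\forall q \near p, (A `*` B) q -> P (f q.2)).
by apply: filterS H => q H [_ /H].
Qed.

Lemma cvg_perturbed_Q A (Du : 'rV[R]_n -> 'rV[R]_n) psi eps p :
  (forall s, 0 <= s -> derivable_halfline psi s) ->
  {within A, continuous Du} -> A p.1 -> A p.2 ->
  perturbed_Q Du psi eps q @[q --> within (A `*` A) (nbhs p)] --> perturbed_Q Du psi eps p.
Proof.
move=> dpsi cDu A1 A2.
have cid : {within A, continuous (@id 'rV[R]_n)}.
  by apply: continuous_in_subspaceT => x _; exact: cvg_id.
have f1 : q.1 @[q --> within (A `*` A) (nbhs p)] --> p.1 by exact: cvg_within_fst cid A1.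
have f2 : q.2 @[q --> within (A `*` A) (nbhs p)] --> p.2 by exact: cvg_within_snd cid A2.
have g1 : Du q.1 @[q --> within (A `*` A) (nbhs p)] --> Du p.1 by exact: cvg_within_fst.
have g2 : Du q.2 @[q --> within (A `*` A) (nbhs p)] --> Du p.2 by exact: cvg_within_snd.
have f12 : q.2 - q.1 @[q --> within (A `*` A) (nbhs p)] --> p.2 - p.1 by exact: cvgB.
apply: cvgD; last by apply: cvgM; [exact: cvg_cst|exact: cvg_dotp].
apply: cvgD; last exact: cvg_halfline_dotp.
by apply: cvg_dotp => //; exact: cvgB.
Qed.

(** A closed subset of a compact product. As [u] and [Du] are continuous relative to [closure A],
    limits are taken along neighbourhoods restricted to the set itself. *)
Lemma compact_superlevel A u (Du : 'rV[R]_n -> 'rV[R]_n) psi eps (m : R) :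
  compact (closure A) ->
  (forall s, 0 <= s -> derivable_halfline psi s) ->
  {within closure A, continuous u} -> {within closure A, continuous Du} ->
  compact [set p | Sigma A u p /\ m <= perturbed_Q Du psi eps p].
Proof.
move=> cA dpsi cu cDu.
have cAA := compact_setX cA cA.
apply: (subclosed_compact _ cAA); last by move=> p [[]].
move=> p clp.
have [A1 A2] : (closure A `*` closure A) p.
  have clAA : closed (closure A `*` closure A).
    by apply: compact_closed cAA; exact: norm_hausdorff.
  by apply: clAA; apply: closureS clp => q [[]].
set N := (X in closure X) in clp.
have NW : within N (nbhs p) --> within (closure A `*` closure A) (nbhs p).
  move=> P nP; have H : \forall q \near p, (closure A `*` closure A) q -> P q by exact: nP.
  change (\forall q \near p, N q -> P q).
  by apply: filterS H => q H [[? ? _] _]; exact: H.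
have PF : ProperFilter (within N (nbhs p)) by exact: within_nbhs_proper.
have inN : \forall q \near within N (nbhs p), N q by exact: withinT.
split.
  split => //.
  have c1 : u q.1 @[q --> within N (nbhs p)] --> u p.1.
    by apply: cvg_trans (cvg_app _ NW) _; exact: cvg_within_fst.
  have c2 : u q.2 @[q --> within N (nbhs p)] --> u p.2.
    by apply: cvg_trans (cvg_app _ NW) _; exact: cvg_within_snd.
  apply/eqP; rewrite -subr_eq0; apply/eqP.
  apply: (@closed_cvg _ _ _ PF (fun q => u q.1 - u q.2) (fun x => x = 0)
    (@closed_eq R 0) _ _ (cvgB c1 c2)).
  by apply: filterS inN => q [[_ _ E] _]; rewrite /= E subrr.
have c3 : perturbed_Q Du psi eps q @[q --> within N (nbhs p)] --> perturbed_Q Du psi eps p.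
  by apply: cvg_trans (cvg_app _ NW) _; exact: cvg_perturbed_Q.
apply: (@closed_cvg _ _ _ PF (perturbed_Q Du psi eps) (fun x => m <= x)
  (@closed_ge R m) _ _ c3).
by apply: filterS inN => q [].
Qed.

(** Yields a real gap from an extended-real one; the value -oo, for empty [S], is replaced by
    [b - 1]. *)
Lemma bounded_strict_sup T (F : T -> R) (S : set T) (b : R) :
  (ereal_sup [set (F p)%:E | p in S] < b%:E)%E ->
  exists2 m, m < b & forall p, S p -> F p <= m.
Proof.
move=> Hb; have ub p : S p -> ((F p)%:E <= ereal_sup [set (F p)%:E | p in S])%E.
  by move=> Sp; apply: ereal_sup_ubound; exists p.
move: ub Hb; case: (ereal_sup _) => [m| |] ub.
- by rewrite lte_fin => mb; exists m => // p /ub; rewrite lee_fin.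
- by rewrite ltNge leey.
- by move=> _; exists (b - 1); [rewrite ltrBlDr ltrDl|move=> p /ub].
Qed.
End TwoPointCompactness.

Lemma continuous_quotient_Q {R : realType} {n : nat} (A : set 'rV[R]_n) u psi (h eps : R)
    (p : 'rV[R]_n * 'rV[R]_n) : C1_on A u ->
  (forall s, 0 <= s -> derivable_halfline psi s) ->
  A (p.1 + h *: (p.2 - p.1)) -> A (p.2 + h *: (p.2 - p.1)) ->
  {for p, continuous (quotient_Q u psi h eps)}.
Proof.
move=> C1 dpsi A1 A2.
have f1 := @nbhs_fst _ _ p; have f2 := @nbhs_snd _ _ p.
have f12 : q.2 - q.1 @[q --> p] --> p.2 - p.1 by exact: cvgB.
have hz : h *: (q.2 - q.1) @[q --> p] --> h *: (p.2 - p.1) by exact: cvgZr.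
have [/differentiable_continuous c1 _] := C1 _ A1.
have [/differentiable_continuous c2 _] := C1 _ A2.
have u1 : u (q.1 + h *: (q.2 - q.1)) @[q --> p] --> u (p.1 + h *: (p.2 - p.1)).
  exact: (cvg_comp _ _ (cvgD f1 hz) c1).
have u2 : u (q.2 + h *: (q.2 - q.1)) @[q --> p] --> u (p.2 + h *: (p.2 - p.1)).
  exact: (cvg_comp _ _ (cvgD f2 hz) c2).
apply: cvgD; last by apply: cvgM; [exact: cvg_cst|exact: cvg_dotp].
apply: cvgD; last exact: cvg_halfline_dotp.
by apply: cvgM; [exact: cvg_cst|exact: cvgB].
Qed.

(** * Reduction of the global statement to the local maximum principle *)

Theorem theorem1p1 (R : realType) (n : nat)
  (Omega0 Omega1 Omega : set 'rV[R]_n)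
  (u : 'rV[R]_n -> R) (Du : 'rV[R]_n -> 'rV[R]_n) (psi : R -> R)
  (dom0 : domain Omega0) (bnd0 : bounded_set Omega0)
  (dom1 : domain Omega1) (bnd1 : bounded_set Omega1)
  (sub10 : closure Omega1 `<=` Omega0)
  (OmegaE : Omega = Omega0 `\` closure Omega1)
  (C1u : C1_closure Omega u Du)
  (harm_u : harmonic_on Omega u)
  (u_bd0 : forall x, boundary Omega0 x -> u x = 0)
  (u_bd1 : forall x, boundary Omega1 x -> u x = 1)
  (Du_neq0 : forall x, Omega x -> Du x <> 0)
  (smooth_psi : smooth_halfline psi)
  (psi_ineq : forall t : R, 0 <= t ->
     0 <= derive_halfline psi t
          - 2 * `|derive_halfline (derive_halfline psi) t| * t) :
  ~ exists x0 y0 : 'rV[R]_n,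
      [/\ Sigma Omega u (x0, y0), Omega x0, Omega y0,
          (Q Du psi (x0, y0))%:E = supE (Q Du psi) (Sigma Omega u)
        & (supE (Q Du psi) (bd_Sigma Omega u)
             < supE (Q Du psi) (Sigma Omega u))%E].
Proof.
move=> [x0 [y0 [S0 inx0 iny0 Q0E]]]; rewrite -Q0E => /bounded_strict_sup.
set Q0 := Q Du psi (x0, y0) => -[m mQ0 bdm].
have oO : open Omega.
  rewrite OmegaE setDE; apply: openI; first by case: dom0.
  by rewrite openC; exact: closed_closure.
have bO : bounded_set Omega.
  have [M [Mr HM]] := bnd0; exists M; split => // N MN x.
  by rewrite OmegaE => -[? _]; exact: HM.
have [M M0 HM] := bounded_closure bO.
have cO : compact (closure Omega).
  apply: bounded_closed_compact; last exact: closed_closure.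
  exists M; split; first exact: num_real.
  by move=> N MN x /HM xM; apply: le_trans xM _; exact: ltW.
have [C1 cu cDu DuE] := C1u.
have dpsi t : 0 <= t -> derivable_halfline psi t by exact: (smooth_psi 0%N).
have ddpsi t : 0 <= t -> derivable_halfline (derive_halfline psi) t.
  exact: (smooth_psi 1%N).
pose C := n%:R * (M * M) + 1.
have C0 : 0 < C by rewrite ltr_wpDl// mulr_ge0// mulr_ge0.
have HC x : closure Omega x -> dotp x x <= C.
  move=> /HM xM; apply: (le_trans (ler_norm _)); apply: (le_trans (dotp_le_norm _ _)).
  by rewrite ler_wpDr// ler_wpM2l// ler_pM.
pose d := Q0 - m.
have d0 : 0 < d by rewrite subr_gt0.
(* The perturbation is then at most a quarter of the gap [d] on the closure. *)
pose eps := d / (4 * C).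
have eps0 : 0 < eps by rewrite divr_gt0// mulr_gt0.
pose Qe := perturbed_Q Du psi eps.
(* Midpoint of the gap: on the boundary [Qe] is at most [m + d / 4 < m'], so the superlevel set [N]
   lies in the interior, while [Qe (x0, y0) >= Q0 > m']. *)
pose m' := (Q0 + m) / 2.
pose N := [set p | Sigma Omega u p /\ m' <= Qe p].
have cN : compact N by exact: compact_superlevel.
have NO p : N p -> Omega p.1 /\ Omega p.2.
  move=> [Sp mp]; apply: contrapT => nO.
  have /bdm : bd_Sigma Omega u p by split => // -[_ in1 in2]; apply: nO.
  have [/HC Cp _ _] := Sp.
  have : eps * dotp p.1 p.1 <= d / 4.
    apply: (@le_trans _ _ (eps * C)); first by rewrite ler_wpM2l// ltW.
    by rewrite le_eqVlt /eps; apply/orP; left; apply/eqP; field; rewrite gt_eqF.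
  by move: mp; rewrite /Qe /perturbed_Q /m' /d; lra.
have QeQ0 : Q0 <= Qe (x0, y0).
  by rewrite /Qe /perturbed_Q lerDl mulr_ge0 ?dotp_ge0// ltW.
have N0 : N (x0, y0) by split => //; apply: le_trans QeQ0; rewrite /m'; lra.
(* The condition on [u] is part of [P] because the covering argument tests whole neighbourhoods,
   which leave [Sigma]. *)
pose P (h : R) (p : 'rV[R]_n * 'rV[R]_n) := u p.1 = u p.2 ->
  [/\ Omega (p.1 + h *: (p.2 - p.1)), Omega (p.2 + h *: (p.2 - p.1))
    & `|quotient_Q u psi h eps p - Qe p| < d / 8].
have d80 : 0 < d / 8 by rewrite divr_gt0.
(* Compactness of [N] turns the local radii into one range of [h] valid on all of [N]. *)
have : \forall h \near (0 : R)^'+, N `<=` P h.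
  apply: ((compact_near_coveringP N).1 cN R _ P _).
  move=> p /NO[in1 in2].
  have [r r0 Hr] := quotient_approx oO C1 in1 in2 d80.
  have n1 : \forall q \near p, `|p.1 - q.1| < r.
    by have /cvgrPdist_lt := @nbhs_fst _ _ p; exact.
  have n2 : \forall q \near p, `|p.2 - q.2| < r.
    by have /cvgrPdist_lt := @nbhs_snd _ _ p; exact.
  have n3 : \forall q \near p, Omega q.1.
    by apply: (@nbhs_fst _ _ p); exact: open_nbhs_nbhs.
  have n4 : \forall q \near p, Omega q.2.
    by apply: (@nbhs_snd _ _ p); exact: open_nbhs_nbhs.
  exists ([set q | (`|p.1 - q.1| < r /\ `|p.2 - q.2| < r) /\ Omega q.1 /\ Omega q.2],
          [set h | 0 < h /\ h < r]).
    split => /=; first by apply: filterI; apply: filterI.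
    by apply: filterI; [exact: nbhs_right_gt|exact: nbhs_right_lt].
  move=> [q h] /= [[[q1 q2] [inq1 inq2]] [h0 hr]] uq.
  have [in3 in4 H] := Hr _ _ _ q1 q2 h0 hr; split => //.
  move: H; rewrite -!DuE//; congr (`|_| < _).
  by rewrite /Qe /perturbed_Q /Q /quotient_Q uq; ring.
move=> Nh.
have [h [h0 PN]] : exists h : R, 0 < h /\ N `<=` P h.
  apply: (@filter_ex _ (0 : R)^'+ _).
  by apply: filterI Nh; exact: nbhs_right_gt.
have {}PN p : N p -> [/\ Omega (p.1 + h *: (p.2 - p.1)), Omega (p.2 + h *: (p.2 - p.1))
    & `|quotient_Q u psi h eps p - Qe p| < d / 8].
  by move=> Np; apply: PN => //; case: Np => -[].
have cF : {within N, continuous (quotient_Q u psi h eps)}.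
  apply: continuous_in_subspaceT => p /set_mem /PN[in1 in2 _].
  exact: (continuous_quotient_Q C1 dpsi in1 in2).
have [[x y] /set_mem Nxy maxF] := compact_EVT_max (ex_intro _ _ N0) cN cF.
have [inx iny] := NO _ Nxy; rewrite /= in inx iny.
have [[_ _ uxy] _] := Nxy; rewrite /= in uxy.
(* Two errors below [d / 8] leave [Qe (x, y) > Q0 - d / 4], strictly above [m' = Q0 - d / 2]. *)
have mQxy : m' < Qe (x, y).
  have := maxF _ (mem_set N0).
  have [_ _] := PN _ Nxy; have [_ _] := PN _ N0.
  rewrite !ltr_norml => /andP[? ?] /andP[? ?].
  by have dE : d = Q0 - m by []; rewrite /m'; lra.
(* The strict inequality persists nearby, so nearby pairs of [Sigma] belong to [N] and a maximum
   over [N] is a local maximum over [Sigma]. *)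
have lmax : \forall p \near (x, y), u p.1 = u p.2 ->
    quotient_Q u psi h eps p <= quotient_Q u psi h eps (x, y).
  have clO z : Omega z -> closure Omega z by exact: subset_closure.
  have H1 := @cvg_perturbed_Q _ _ _ _ _ eps (x, y) dpsi cDu (clO _ inx) (clO _ iny).
  have H2 : \forall p \near (x, y), (closure Omega `*` closure Omega) p -> m' < Qe p.
    by have /cvgr_gt/(_ _ mQxy) := H1.
  have H3 : \forall p \near (x, y), Omega p.1 /\ Omega p.2.
    apply: filterI; [apply: (@nbhs_fst _ _ (x, y))|apply: (@nbhs_snd _ _ (x, y))];
      exact: open_nbhs_nbhs.
  apply: filterS2 H2 H3 => p Hp [in1 in2] up.
  apply: maxF; apply: mem_set; split; first by split => //; exact: clO.
  by apply: ltW; apply: Hp; split; exact: clO.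
have gradE z : Omega z -> grad u z != 0.
  by move=> Oz; apply/eqP; rewrite -DuE//; exact: Du_neq0.
have [xyE|xy] := eqVneq x y.
  by subst y; exact: (diagonal_no_local_max (gradE _ inx) eps0 lmax).
have [in1 in2 _] := PN _ Nxy.
exact: (two_point_no_local_max oO harm_u inx iny uxy (gradE _ iny) in1 in2 xy dpsi ddpsi
  psi_ineq eps0 lmax).
Qed.
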